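(* Fix $P\in\mathcal P$ and a measurable map $w:\mathcal X\to\mathcal W_{\mathrm{aux}}$. (i) If $\mathcal P$ satisfies marginal reweighting closure, then every $f\in\mathcal F_{\mathrm B}$ satisfies $E_{Q_x^P}[f_w^P(x,\cdot)]=\psi(x,u_P(x))$ for $P_X$-a.e. $x$, and, in the extended-real sense, $$\mathrm{Var}_P[f_w^P]=\mathrm{Var}_{P_X}[\psi(X,u_P(X))]+E_{P_X}\big[\mathrm{Var}_{Q_X^P}\{f_w^P(X,\cdot)\}\big]\ \ge\ V_{\mathrm{low}}(P).$$ Moreover $\inf_{f\in\mathcal F_{\mathrm B}}\mathrm{Var}_P[f_w^P]=V_{\mathrm{low}}(P)$. (ii) If $\mathcal P$ satisfies marginal reweighting closure, integrable kernel substitution, locality and measurability, then for every $f\in\mathcal F_{\mathrm B}$ there is a $P_X$-null set (which may depend on $(f,P,w)$) such that for every $x$ outside it, every $j\in\{1,\dots,d\}$, every $Q'\in\mathfrak Q_x^P$, and every $v$ for which there is $R\in\mathfrak K_x$ with $\eta_{\mathrm{loc},l}(x,R)=\eta_l(P)(x)$ for all $l\ne j$ and $\eta_{\mathrm{loc},j}(x,R)=v$, the following integral is absolutely convergent and $$E_{Q'}\big[f\big(x,W,\eta_1(P)(x),\dots,v,\dots,\eta_d(P)(x),\kappa(P)(x),w(x)\big)\big]=\bar\psi\big(x,\eta(P)(x),\kappa(P)(x)\big),$$ where $v$ is placed in the $j$-th nuisance position.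
   Context: General framework. $\mathcal X,\mathcal W$ are Polish spaces and $\mathcal P$ is a fixed class of Borel probability measures on $\mathcal X\times\mathcal W$. For $P\in\mathcal P$, $P_X$ is the marginal on $\mathcal X$ and $Q_x^P$ the regular conditional law of $W$ given $X=x$. Variances of integrable functions take values in $[0,\infty]$. The target $\Psi:\mathcal P\to\mathbb R$ has the form $\Psi(P)=E_{P_X}[\psi(X,u_P(X))]$ with $\mathcal U$ Polish, $\psi:\mathcal X\times\mathcal U\to\mathbb R$ measurable, $u_P:\mathcal X\to\mathcal U$ measurable, $\psi(\cdot,u_P(\cdot))\in L^1(P_X)$, and $u_P(x)=u_{\mathrm{loc}}(x,Q_x^P)$ for one rule $u_{\mathrm{loc}}$. Nuisance declaration. $\eta=(\eta_1,\dots,\eta_d)$, $d\ge1$, where for each $P$, $\eta_j(P):\mathcal X\to\mathcal N_{0,j}$ is measurable into a Polish space; $\mathcal N_0=\prod_j\mathcal N_{0,j}$; $\kappa(P):\mathcal X\to\mathcal K_0$ (Polish) is measurable with $\kappa(P)(x)=\kappa_\flat(x,\eta(P)(x))$ for a measurable $\kappa_\flat:\mathcal X\times\mathcal N_0\to\mathcal K_0$; $\mathcal W_{\mathrm{aux}}$ is a Polish space. There is a measurable $\bar\psi:\mathcal X\times\mathcal N_0\times\mathcal K_0\to\mathbb R$ with $\psi(x,u_P(x))=\bar\psi(x,\eta(P)(x),\kappa(P)(x))$ $P_X$-a.s. for every $P\in\mathcal P$. The class $\mathcal F_{\mathrm B}$ consists of all measurable $f:\mathcal X\times\mathcal W\times\mathcal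 N_0\times\mathcal K_0\times\mathcal W_{\mathrm{aux}}\to\mathbb R$ such that for all $P,P'\in\mathcal P$ and all measurable $w:\mathcal X\to\mathcal W_{\mathrm{aux}}$: if for some $j$ one has $\eta_l(P')=\eta_l(P)$ $P_X$-a.s. for all $l\ne j$, then $f(X,W,\eta(P')(X),\kappa(P)(X),w(X))\in L^1(P)$ and its $P$-expectation equals $\Psi(P)$. Write $f_w^P(x,W)=f(x,W,\eta(P)(x),\kappa(P)(x),w(x))$. Variance floor. $V^{\min}(\cdot;P)$ is the essential infimum in $L^0(P_X)$ of the functions $x\mapsto\mathrm{Var}_{Q_x^P}[f_w^P(x,\cdot)]$ over $f\in\mathcal F_{\mathrm B}$ with $\mathrm{Var}_P[f_w^P]<\infty$ (equal to $+\infty$ if there is no such $f$), and $V_{\mathrm{low}}(P)=\mathrm{Var}_{P_X}[\psi(X,u_P(X))]+E_{P_X}[V^{\min}(X;P)]$. These do not depend on the measurable $w$ used to define them. Model conditions. Fix a Borel graph $\{(x,Q):Q\in\mathfrak K_x\}$ of admissible conditional laws on $\mathcal W$, and maps $\eta_{\mathrm{loc}}(x,Q)\in\mathcal N_0$, $\kappa_{\mathrm{loc}}(x,Q)\in\mathcal K_0$ on it. Put $\mathfrak Q_x^P=\{Q\in\mathfrak K_x:\eta_{\mathrm{loc}}(x,Q)=\eta(P)(x),\ \kappa_{\mathrm{loc}}(x,Q)=\kappa(P)(x)\}$. - Marginal reweighting closure: for $P\in\mathcal P$ and measurable $A$ with $P_X(A)>0$, the law $P|_A$ with marginal $P_X(\cdot\cap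 A)/P_X(A)$ and unchanged conditional kernel is in $\mathcal P$, with the same values of $\eta,\kappa$ as $P$ on $A$. - Integrable kernel substitution: there is a finite Borel cost $C(x,Q)\ge1$ on the graph, controlling the absolute target integrand and the moments required by the model; every $P\in\mathcal P$ has $Q_x^P\in\mathfrak K_x$ a.s. and $\int C(x,Q_x^P)\,dP_X<\infty$; every universally measurable selection $R_x\in\mathfrak K_x$ with $\int C(x,R_x)\,dP_X<\infty$ defines (with marginal $P_X$) a law in $\mathcal P$. - Locality: for $P_X$-a.e. $x$, $\eta(P)(x)=\eta_{\mathrm{loc}}(x,Q_x^P)$ and $\kappa(P)(x)=\kappa_{\mathrm{loc}}(x,Q_x^P)$, and similarly for the target integrand. - Measurability: $\eta_{\mathrm{loc}},\kappa_{\mathrm{loc}}$, $(x,Q)\mapsto\psi(x,u_{\mathrm{loc}}(x,Q))$ and $C$ are Borel on the graph, $|\psi(x,u_{\mathrm{loc}}(x,Q))|\le C(x,Q)$, and universally measurable selections are interpreted in the $P_X$-completion (replaced by Borel versions when forming kernels). *)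

(* Defs.v *)
From HB Require Import structures.
From mathcomp Require Import all_boot all_order all_algebra.
From mathcomp Require Import all_classical all_reals all_analysis.
From mathcomp Require Import measurable_realfun giry.

Set Implicit Arguments.
Unset Strict Implicit.
Unset Printing Implicit Defensive.

Import Order.TTheory GRing.Theory Num.Theory.
Import numFieldNormedType.Exports.

Local Open Scope classical_set_scope.
Local Open Scope ring_scope.

Definition is_polish (R : realType) (T : topologicalType) : Prop :=
  (exists2 D : set T, countable D & dense D) /\
  exists dist : T -> T -> R,
    [/\ forall x y, dist x y = 0 <-> x = y,
        forall x y, dist x y = dist y x,
        forall x y z, dist x z <= dist x y + dist y z,
        forall (x : T) (A : set T), nbhs x A <->
          exists2 e : R, 0 < e & [set y | dist x y < e] `<=` A
      & forall s : nat -> T,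
          (forall e : R, 0 < e -> exists N : nat, forall m n : nat,
             (N <= m)%N -> (N <= n)%N -> dist (s m) (s n) < e) ->
          exists l : T, s @ \oo --> l].

HB.mixin Record isPolishBorel (R : realType) (d : measure_display) T
    of Topological T & Measurable d T := {
  polishP : is_polish R T ;
  borelE : @measurable d T = <<s @open T >>
}.

#[short(type="polishType")]
HB.structure Definition PolishBorel (R : realType) (d : measure_display) :=
  {T of Topological T & Measurable d T & isPolishBorel R d T}.

Section dependent_product.
Context (n : nat) (dN : 'I_n -> measure_display)
  (N0 : forall j : 'I_n, measurableType (dN j)).

Definition cylinders : set_system (forall j, N0 j) :=
  \bigcup_j preimage_set_system setT (fun v : forall j, N0 j => v j) measurable.

Definition nprod : measurableType cylinders.-sigma :=
  g_sigma_algebraType cylinders.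

End dependent_product.

(** Laws.  A [probability] also carries values on non-measurable sets, so that a
    Borel law is a class of [probability] terms modulo [measure_eq]; whatever is
    said below to depend on a law only must be compatible with it.  The Borel
    sets of the space of laws on W are those of [pprobability W R], the
    sigma-algebra generated by the evaluations at measurable sets. *)

Section laws.
Context {R : realType} {dX dW : measure_display}
  {X : measurableType dX} {W : measurableType dW}.

HB.instance Definition _ :=
  isMeasurableFun.Build _ _ _ _ (@fst X W) measurable_fst.

Definition marginal (P : probability (X * W)%type R) : probability X R :=
  distribution P (@fst X W).

(** P is the law on X * W with marginal m and conditional kernel k. *)
Definition is_joint_law (P : probability (X * W)%type R)
    (m : probability X R) (k : X -> probability W R) : Prop :=
  forall (A : set X) (B : set W), measurable A -> measurable B ->
    P (A `*` B) = (\int[m]_(x in A) k x B)%E.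

Definition is_cond_law (P : probability (X * W)%type R)
    (k : X -> probability W R) : Prop :=
  measurable_fun setT (k : X -> pprobability W R) /\
  is_joint_law P (marginal P) k.

End laws.

Section ess_inf_family.
Context {R : realType} {dX : measure_display} {X : measurableType dX}.
Variables (m : probability X R) (H : set (X -> \bar R)).

(** g is a version of the greatest lower bound of H in L^0(m). *)
Definition is_ess_inf (g : X -> \bar R) : Prop :=
  [/\ measurable_fun setT g,
      forall h, H h -> \forall x \ae m, (g x <= h x)%E
    & forall g' : X -> \bar R, measurable_fun setT g' ->
        (forall h, H h -> \forall x \ae m, (g' x <= h x)%E) ->
        \forall x \ae m, (g' x <= g x)%E].

(** Some version; when H is empty every version is +oo almost surely. *)
Definition ess_inf_family : X -> \bar R := xget (cst +oo%E) is_ess_inf.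

End ess_inf_family.

(** The preimage of each measurable set differs from a measurable set by a
    null set, whatever the probability on the source. *)
Definition universally_measurable (R : realType) (d1 d2 : measure_display)
    (T1 : measurableType d1) (T2 : measurableType d2) (g : T1 -> T2) : Prop :=
  forall (mu : probability T1 R) (B : set T2), measurable B ->
    exists2 A : set T1, measurable A & mu.-negligible ((g @^-1` B) `+` A).

Section framework.
Context {R : realType} {d : nat} {dX dW dU dK dA : measure_display}
  {dN : 'I_d -> measure_display}
  {X : polishType R dX} {W : polishType R dW} {U : polishType R dU}
  {N0 : forall j : 'I_d, polishType R (dN j)}
  {K0 : polishType R dK} {Waux : polishType R dA}.

Local Notation XW := (X * W)%type.
Local Notation N := (nprod (fun j => N0 j)).

Record framework := Framework {
  laws : set (probability XW R);
  (* Q_x^P, as a version of the regular conditional law of W given X *)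
  Q : probability XW R -> X -> probability W R;
  Q_cond : forall P, laws P -> is_cond_law P (Q P);

  psi : X * U -> R;
  psi_meas : measurable_fun setT psi;
  u : probability XW R -> X -> U;
  u_meas : forall P, laws P -> measurable_fun setT (u P);
  psi_int : forall P, laws P ->
    (marginal P).-integrable setT (fun x => (psi (x, u P x))%:E);
  u_loc : X -> probability W R -> U;
  u_loc_eq : forall x (Q1 Q2 : probability W R), measure_eq Q1 Q2 ->
    u_loc x Q1 = u_loc x Q2;
  (* almost surely, as Q P is only determined up to a null set *)
  u_locE : forall P, laws P ->
    \forall x \ae marginal P, u P x = u_loc x (Q P x);

  eta : probability XW R -> X -> N;
  eta_meas : forall P, laws P -> forall j,
    measurable_fun setT (fun x => eta P x j);
  kappa : probability XW R -> X -> K0;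
  kappa_meas : forall P, laws P -> measurable_fun setT (kappa P);
  kappa_flat : X * N -> K0;
  kappa_flat_meas : measurable_fun setT kappa_flat;
  kappaE : forall P, laws P -> forall x, kappa P x = kappa_flat (x, eta P x);

  psi_bar : X * N * K0 -> R;
  psi_bar_meas : measurable_fun setT psi_bar;
  psi_barE : forall P, laws P ->
    \forall x \ae marginal P,
      psi (x, u P x) = psi_bar (x, eta P x, kappa P x)
}.

Local Open Scope ereal_scope.

Definition target (S : framework) (P : probability XW R) : \bar R :=
  'E_(marginal P)[fun x => psi S (x, u S P x)].

Definition plug (f : X * W * N * K0 * Waux -> R)
    (n : X -> N) (k : X -> K0) (w : X -> Waux) (z : XW) : R :=
  f (z.1, z.2, n z.1, k z.1, w z.1).

Definition FB (S : framework) : set (X * W * N * K0 * Waux -> R) :=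
  [set f | measurable_fun setT f /\
    forall (P P' : probability XW R) (w : X -> Waux),
      laws S P -> laws S P' -> measurable_fun setT w ->
      (exists j : 'I_d, forall l : 'I_d, l != j ->
         \forall x \ae marginal P, eta S P' x l = eta S P x l) ->
      P.-integrable setT (EFin \o plug f (eta S P') (kappa S P) w) /\
      'E_P[plug f (eta S P') (kappa S P) w] = target S P].

(** f_w^P *)
Definition score (S : framework) (f : X * W * N * K0 * Waux -> R)
    (P : probability XW R) (w : X -> Waux) : XW -> R :=
  plug f (eta S P) (kappa S P) w.

Definition cond_mean (S : framework) (f : X * W * N * K0 * Waux -> R)
    (P : probability XW R) (w : X -> Waux) (x : X) : \bar R :=
  'E_(Q S P x)[fun y => score S f P w (x, y)].

Definition cond_var (S : framework) (f : X * W * N * K0 * Waux -> R)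
    (P : probability XW R) (w : X -> Waux) (x : X) : \bar R :=
  'V_(Q S P x)[fun y => score S f P w (x, y)].

Definition Vmin (S : framework) (P : probability XW R) (w : X -> Waux) :
    X -> \bar R :=
  ess_inf_family (marginal P)
    [set cond_var S f P w | f in [set f | FB S f /\
                                   'V_P[score S f P w] < +oo]].

Definition Vlow (S : framework) (P : probability XW R) (w : X -> Waux) :
    \bar R :=
  'V_(marginal P)[fun x => psi S (x, u S P x)]
   + \int[marginal P]_x Vmin S P w x.

(** "The same values on A" is up to null sets: on an atomless marginal, equality
    at every point of A would force the nuisances of any two laws that agree on
    a set of positive measure to coincide everywhere. *)
Definition reweighting_closure (S : framework) : Prop :=
  forall P, laws S P -> forall (A : set X) (mA : measurable A),
    0 < marginal P A ->
    forall P' : probability XW R,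
      is_joint_law P' (mnormalize (mrestr (marginal P) mA) (marginal P))
        (Q S P) ->
      laws S P' /\
      \forall x \ae marginal P, A x ->
        eta S P' x = eta S P x /\ kappa S P' x = kappa S P x.

(** The local rules are total functions; only their values on the graph of
    [adm] matter. *)
Record local_rules := LocalRules {
  adm : X -> set (probability W R);
  eta_loc : X -> probability W R -> N;
  kappa_loc : X -> probability W R -> K0;
  cost : X -> probability W R -> R
}.

Definition adm_graph (L : local_rules) : set (X * pprobability W R) :=
  [set p | adm L p.1 p.2].

Definition fiber (S : framework) (L : local_rules) (P : probability XW R)
    (x : X) : set (probability W R) :=
  [set Q' | [/\ adm L x Q', eta_loc L x Q' = eta S P x
             & kappa_loc L x Q' = kappa S P x]].

(** Selections are taken in the completion of the marginal, hence admissible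
    almost surely: [adm] may have empty sections over
    null sets.  [r'] is a Borel version of the selection [r]. *)
Definition kernel_substitution (S : framework) (L : local_rules) : Prop :=
  [/\ forall x Q', adm L x Q' -> (1 <= cost L x Q')%R,
      forall P, laws S P -> \forall x \ae marginal P, adm L x (Q S P x),
      forall P, laws S P ->
        \int[marginal P]_x (cost L x (Q S P x))%:E < +oo
    & forall P, laws S P -> forall r : X -> probability W R,
        universally_measurable R (r : X -> pprobability W R) ->
        (\forall x \ae marginal P, adm L x (r x)) ->
        \int[marginal P]_x (cost L x (r x))%:E < +oo ->
        forall r' : X -> probability W R,
          measurable_fun setT (r' : X -> pprobability W R) ->
          (\forall x \ae marginal P, measure_eq (r' x) (r x)) ->
          forall P' : probability XW R,
            is_joint_law P' (marginal P) r' -> laws S P'].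

Definition locality (S : framework) (L : local_rules) : Prop :=
  forall P, laws S P -> \forall x \ae marginal P,
    [/\ eta S P x = eta_loc L x (Q S P x),
        kappa S P x = kappa_loc L x (Q S P x)
      & psi S (x, u S P x) = psi S (x, u_loc S x (Q S P x))].

Definition local_measurability (S : framework) (L : local_rules) : Prop :=
  [/\ measurable_fun (adm_graph L) (fun p => eta_loc L p.1 p.2),
      measurable_fun (adm_graph L) (fun p => kappa_loc L p.1 p.2),
      measurable_fun (adm_graph L) (fun p => psi S (p.1, u_loc S p.1 p.2)),
      measurable_fun (adm_graph L) (fun p => cost L p.1 p.2)
    & forall x Q', adm L x Q' -> (`|psi S (x, u_loc S x Q')| <= cost L x Q')%R].

End framework.
Arguments framework {R d dX dW dU dK dN} X W U N0 K0.
Arguments local_rules {R d dX dW dK dN} X W N0 K0.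

(* Main.v *)
(** Conditioning P on a set A of positive mass does not change its kernel, so
    reweighting closure turns the moment identity of f into an identity on every
    A: the conditional mean of f given x is psi(x, u_P(x)) for almost every x,
    even when one nuisance coordinate is that of another law.  The variance
    decomposition follows.  Consequently F_B is stable under pasting f and g
    along a measurable set of x, the conditional variances are stable under
    minimum, and a minimizing sequence converges to their essential infimum.

    For (ii), suppose that the set of x carrying a bad pair (Q', R) is not null.
    A measurable choice (Q'_x, R_x) on a set of positive mass, truncated so that
    the cost is bounded, yields by kernel substitution two laws of the model
    whose nuisances differ in the coordinate j only, and these violate the
    conditional identity.  The choice is available because a measurable subset
    of X * N^N is given by a Souslin scheme: bounding the branches of the scheme
    one coordinate at a time keeps almost all of the outer measure of the
    projection, after which the leftmost bounded branch is measurable.  Laws on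
    W are parametrized by N^N by embedding W into the real line and coding
    quantile functions by sets of pairs of rationals. *)

From HB Require Import structures.
Require Import Defs.
From mathcomp Require Import all_boot all_order all_algebra.
From mathcomp Require Import all_classical all_reals all_analysis.
From mathcomp Require Import measurable_realfun giry.
From mathcomp Require Import ring lra.

Set Implicit Arguments.
Unset Strict Implicit.
Unset Printing Implicit Defensive.

Import Order.TTheory GRing.Theory Num.Theory.
Import numFieldNormedType.Exports.

Local Open Scope classical_set_scope.
Local Open Scope ereal_scope.

(** * Measurable selection *)

(** The obstacle in (ii) is that the bad [x] form the projection of a Borel set, in general analytic
    and not Borel. A contradiction asks for a selection only on a Borel set of positive mass,
    because the kernel of [P] can be kept off that set; hence the compactness of bounded branches is
    enough, and no uniformization of the whole projection is sought. Two laws are built because a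
    member of F_B is tested with the conditional law, target and kappa of one law and the eta of
    another. The first receives the kernel [Q'_x] and shares both nuisances with [P]; the second
    receives [R_x] and contributes only its eta. The value [v] is never selected, being read off
    [R_x]. A [probability] term is more than a Borel law, and a conditional law is determined only
    almost surely and up to [measure_eq]. This is why measurable sets and functions of laws are
    shown to be invariant, and why uniqueness of conditional laws goes through a countable
    generating pi-system. *)

Definition cylinder (n i : nat) : set (nat -> nat) := [set y | y n = i].

Definition baire : Type :=
  g_sigma_algebraType [set C | exists n i, C = cylinder n i].
HB.instance Definition _ := Measurable.on baire.

Lemma measurable_cylinder n i : measurable (cylinder n i : set baire).
Proof. by apply: sub_sigma_algebra; exists n, i. Qed.

Section suslin.
Context {d : measure_display} {X : measurableType d}.
Implicit Types (y s : nat -> nat).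

(** Souslin schemes over [X], in which [s] is the branch and [y] the point of
    the Baire space. *)
Definition suslin (B : set (X * baire)) : Prop :=
  exists (D : nat -> nat) (E : nat -> (nat -> nat) -> (nat -> nat) -> set X),
  [/\ forall n y s, measurable (E n y s),
      forall n y y' s s',
        (forall i, (i < D n)%N -> y i = y' i /\ s i = s' i) ->
        E n y s = E n y' s'
    & forall x y, B (x, y) <-> exists s, forall n, E n y s x].

(** Souslin sets are in general not stable under complement; asking for both sides gives a
    sigma-algebra, to which induction on Borel sets applies. *)
Definition bisuslin (B : set (X * baire)) := suslin B /\ suslin (~` B).

Lemma suslin_finite (B : set (X * baire)) N :
  (forall y, measurable [set x | B (x, y)]) ->
  (forall x y y', (forall i, (i < N)%N -> y i = y' i) ->
     B (x, y) -> B (x, y')) ->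
  suslin B.
Proof.
move=> mB detB; exists (fun=> N), (fun _ y _ => [set x | B (x, y)]).
split=> [n y s||x y]; first exact: mB.
- by move=> _ y y' s s' yy'; apply/seteqP; split => x /=; apply: detB => i iN;
    have [] := yy' i iN.
- by split=> [Bxy|[s /(_ 0%N)]//]; exists (fun=> 0%N).
Qed.

Lemma bisuslin_finite (B : set (X * baire)) N :
  (forall y, measurable [set x | B (x, y)]) ->
  (forall x y y', (forall i, (i < N)%N -> y i = y' i) ->
     B (x, y) -> B (x, y')) ->
  bisuslin B.
Proof.
move=> mB detB; split; apply: (@suslin_finite _ N) => //.
- by move=> y; exact: measurableC (mB y).
- move=> x y y' yy' nB By'; apply: nB; apply: detB By' => i iN.
  by rewrite yy'.
Qed.

(** The default is harmless: an index that codes no pair repeats the condition attached to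
    [(0, 0)]. *)
Definition unpair (m : nat) : nat * nat := odflt (0, 0)%N (unpickle m).

Lemma unpairK (p : nat * nat) : unpair (pickle p) = p.
Proof. by rewrite /unpair pickleK. Qed.

(** The entry [s 0] names a member of the union and the rest of [s] is a branch for it; the
    conditions of the other members are switched off. *)
Lemma suslin_bigcup (B : (set (X * baire))^nat) :
  (forall i, suslin (B i)) -> suslin (\bigcup_i B i).
Proof.
move=> /choice[D] /choice[E] /all_and3[mE detE BE].
exists (fun m => let p := unpair m in (D p.1 p.2).+1).
exists (fun m y s => let p := unpair m in
  if s 0%N == p.1 then E p.1 p.2 y (s \o succn) else setT).
split=> [m y s|m y y' s s' /= yy'|x y] /=.
- by case: ifP => // _; exact: mE.
- have -> : s 0%N = s' 0%N by case: (yy' 0%N).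
  case: ifP => // _; apply: detE => i iD.
  split; first by case: (yy' i (ltnW iD)).
  by case: (yy' i.+1 iD).
- split=> [[i _ /BE[s sE]]|[s sE]].
    exists (fun n => if n is n'.+1 then s n' else i) => m.
    by case: eqP => // <-; exact: sE.
  exists (s 0%N) => //; apply/BE; exists (s \o succn) => n.
  by have := sE (pickle (s 0, n)%N); rewrite unpairK /= eqxx.
Qed.

(** One branch codes countably many: [sub i s] reads [s] at the codes of the pairs [(i, k)]. The new
    depth must reach the codes of all [(i, k)] with [k] below the original depth. *)
Lemma suslin_bigcap (B : (set (X * baire))^nat) :
  (forall i, suslin (B i)) -> suslin (\bigcap_i B i).
Proof.
move=> /choice[D] /choice[E] /all_and3[mE detE BE].
pose sub (i : nat) (s : nat -> nat) := fun k : nat => s (pickle (i, k)).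
exists (fun m => let p := unpair m in
  maxn (D p.1 p.2) (\max_(k < D p.1 p.2) (pickle (p.1, k : nat)).+1)).
exists (fun m y s => let p := unpair m in E p.1 p.2 y (sub p.1 s)).
split=> [m y s|m y y' s s' /= yy'|x y] /=.
- exact: mE.
- apply: detE => i iD; split.
    by case: (yy' i) => //; rewrite (leq_trans iD)// leq_maxl.
  rewrite /sub; case: (yy' (pickle ((unpair m).1, i))) => //.
  apply: leq_trans (leq_maxr _ _).
  exact: (leq_bigmax (F := fun k : 'I__ => (pickle ((unpair m).1, k : nat)).+1) (Ordinal iD)).
- split=> [BI|[s sE] i _].
    have /choice[s sE] i : exists s, forall n, E i n y s x by apply/BE/BI.
    exists (fun m => let p := unpair m in s p.1 p.2) => m.
    rewrite [X in E _ _ _ X](_ : _ = s (unpair m).1) //.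
    by apply/funext => k; rewrite /sub unpairK.
  apply/BE; exists (sub i s) => n.
  by have := sE (pickle (i, n)); rewrite unpairK.
Qed.

Lemma sigma_algebra_bisuslin : sigma_algebra setT bisuslin.
Proof.
split.
- apply: (@bisuslin_finite _ 0%N) => // y.
  by rewrite [X in measurable X](_ : _ = set0)//; apply/seteqP; split.
- by move=> A [sA sCA]; rewrite setTD; split => //; rewrite setCK.
- move=> A sA; split; first by apply: suslin_bigcup => n; case: (sA n).
  by rewrite setC_bigcup; apply: suslin_bigcap => n; case: (sA n).
Qed.

Lemma measurable_suslin (B : set (X * baire)) : measurable B -> suslin B.
Proof.
suff : measurable `<=` bisuslin by move=> + /[dup] _ mB => /(_ _ mB)[].
apply: smallest_sub; first exact: sigma_algebra_bisuslin.
rewrite subUset; split=> _ [A mA <-]; rewrite setTI.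
  by apply: (@bisuslin_finite _ 0%N).
have [b0 bC bU] := sigma_algebra_bisuslin.
move: A mA.
apply: (@smallest_sub _ _ _ [set A | bisuslin (snd @^-1` A)]).
  split=> [|A bA|A bA] /=; first by rewrite preimage_set0.
    by rewrite setTD preimage_setC -setTD; exact: bC.
  by rewrite preimage_bigcup; exact: bU.
move=> _ [n [i ->]]; apply: (@bisuslin_finite _ n.+1).
  move=> y; have [yn|yn] := eqVneq (y n) i.
    by rewrite [X in measurable X](_ : _ = setT)//; apply/seteqP; split.
  rewrite [X in measurable X](_ : _ = set0)//.
  by apply/seteqP; split => // x /eqP; rewrite (negbTE yn).
by move=> x y y' yy'; rewrite /= /cylinder/= yy'.
Qed.

End suslin.

(** * Outer measure and measurable choice of a branch *)

Section selection.
Context {d : measure_display} {X : measurableType d} {R : realType}.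
Variable m : probability X R.

(** A bound on the outer measure, since the projections it is applied to need not be measurable. *)
Definition small (e : R) (S : set X) : Prop :=
  exists A, [/\ measurable A, S `<=` A & m A <= e%:E].

Lemma small_subset e S S' : S `<=` S' -> small e S' -> small e S.
Proof. by move=> SS' [A [mA S'A Ae]]; exists A; split => //; apply: subset_trans S'A. Qed.

(** Outer measure is continuous along nondecreasing sequences: the covers are replaced by their tail
    intersections [A'], which still cover and are nondecreasing. *)
Lemma small_bigcup e (S : (set X)^nat) :
  {homo S : i j / (i <= j)%N >-> i `<=` j} ->
  (forall i, small e (S i)) -> small e (\bigcup_i S i).
Proof.
move=> ndS /choice[A] /all_and3[mA SA Ae].
pose A' j := \bigcap_(i >= j) A i.
have mA' j : measurable (A' j) by apply: bigcap_measurable => //; exists j => /=.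
exists (\bigcup_j A' j); split; first exact: bigcupT_measurable.
- move=> x [i _ Six]; exists i => // j /= ij.
  by apply/SA/(ndS i).
- have ndA' : nondecreasing_seq A'.
    move=> i j ij; apply/subsetPset => x A'x k /= jk.
    by apply: A'x; exact: leq_trans jk.
  have cvgA' : (m \o A') n @[n --> \oo] --> m (\bigcup_j A' j).
    by apply: nondecreasing_cvg_mu => //; exact: bigcupT_measurable.
  rewrite -(cvg_lim _ cvgA')//; apply: lime_le; first exact: cvgP cvgA'.
  apply: nearW => n; apply: le_trans (Ae n).
  apply: le_measure; rewrite ?inE//.
  by move=> x A'x; apply: A'x => /=.
Qed.

Lemma negligible_small S :
  (forall e : R, (0 < e)%R -> small e S) -> m.-negligible S.
Proof.
move=> sS; have /choice[A] n : exists A,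
    [/\ measurable A, S `<=` A & m A <= (n.+1%:R^-1)%:E].
  exact: sS.
move=> /all_and3[mA SA Ae].
have mI : measurable (\bigcap_n A n) by exact: bigcapT_measurable.
exists (\bigcap_n A n); split=> //; last by move=> x Sx n _; exact: SA.
apply/eqP; rewrite eq_le measure_ge0 andbT.
apply/lee_addgt0Pr => e e0; rewrite add0e.
have [n] := ltr_add_invr e0; rewrite add0r => ne.
apply: le_trans (_ : m (A n) <= _).
  by apply: le_measure; rewrite ?inE//; move=> x; apply.
by apply: le_trans (Ae n) _; rewrite lee_fin ltW.
Qed.


Section scheme.
Variables (D : nat -> nat) (C : nat -> (nat -> nat) -> set X).
Hypothesis mC : forall n t, measurable (C n t).
Hypothesis detC : forall n t t',
  (forall i, (i < D n)%N -> t i = t' i) -> C n t = C n t'.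

Let bounded (s : seq nat) (t : nat -> nat) :=
  forall i, (i < size s)%N -> (t i <= nth 0 s i)%N.

Let proj (s : seq nat) : set X :=
  [set x | exists2 t, bounded s t & forall n, C n t x].

(** The sets [proj (rcons s j)] increase with [j] and cover [proj s], so they cannot all be
    small. *)
Let proj_rcons e s : ~ small e (proj s) ->
  exists j, ~ small e (proj (rcons s j)).
Proof.
move=> nsm; apply: contrapT => /forallNP sm; apply: nsm.
apply: (@small_subset _ _ (\bigcup_j proj (rcons s j))).
  move=> x [t bt Ct]; exists (t (size s)) => //; exists t => // i.
  rewrite size_rcons ltnS nth_rcons leq_eqVlt => /predU1P[->|is_].
    by rewrite ltnn eqxx.
  by rewrite is_; exact: bt.
apply: small_bigcup => [i j ij x [t bt Ct]|i].
  exists t => // l; rewrite size_rcons => ls.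
  apply: leq_trans (bt l _) _; first by rewrite size_rcons.
  by rewrite !nth_rcons; case: ifP => // _; case: ifP.
by apply: contrapT; exact: sm.
Qed.

Let approx (k : nat -> nat) (n : nat) : set X :=
  [set x | exists2 s, (forall i, (s i <= k i)%N) &
    forall j, (j < n)%N -> C j s x].

Section bound.
Variable k : nat -> nat.

Let acc (n : nat) (s : seq nat) : set X :=
  [set x | exists t, [/\ forall i, (t i <= k i)%N,
    forall i, (i < size s)%N -> t i = nth 0%N s i
    & forall j, (j < n)%N -> C j t x]].

(** Only the first [N] entries of a branch matter, so the choice of a branch becomes a countable
    union over finite sequences continued by zeros, which stay below [k]. *)
Let measurable_acc n s : measurable (acc n s).
Proof.
pose N := maxn (size s) (\max_(j < n) D j).
pose ok (p : seq nat) := (forall i, (nth 0 p i <= k i)%N) /\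
  (forall i, (i < size s)%N -> nth 0%N p i = nth 0%N s i).
rewrite [X in measurable X](_ : _ = \bigcup_(p : seq nat)
    (if `[< ok p >] then \bigcap_(j in `I_n) C j (nth 0%N p) else set0)).
  apply: countable_bigcupT_measurable => // p; case: ifP => // _.
  exact: bigcap_measurableType.
apply/seteqP; split => x.
  move=> [t [tk ts tC]]; exists (mkseq t N) => //.
  have tE i : (i < N)%N -> nth 0%N (mkseq t N) i = t i.
    by move=> iN; rewrite nth_mkseq.
  case: asboolP => [_ j /= jn|[]].
    rewrite (@detC _ _ t); first exact: tC.
    move=> i iD; apply: tE; apply: leq_trans iD (leq_trans _ (leq_maxr _ _)).
    exact: (leq_bigmax (F := fun j : 'I_n => D j) (Ordinal jn)).
  split=> i.
    have [iN|Ni] := ltnP i N; first by rewrite tE.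
    by rewrite nth_default// size_mkseq.
  by move=> si; rewrite tE ?ts// (leq_trans si)// leq_maxl.
move=> [p _]; case: asboolP => // -[pk ps] pC.
by exists (nth 0%N p).
Qed.

Let lim_acc s := \bigcap_n acc n s.

Let measurable_lim_acc s : measurable (lim_acc s).
Proof. exact: bigcapT_measurable. Qed.

(** Otherwise every [j <= k (size s)] dies at some level [b j]. These being finitely many, a branch
    that survives up to the largest level extends [s] by one of them, a contradiction. *)
Let lim_acc_rcons s x : lim_acc s x ->
  exists2 j, (j <= k (size s))%N & lim_acc (rcons s j) x.
Proof.
move=> sx; apply: contrapT => /forall2NP nx.
have /choice[b bP] j : exists n, (j <= k (size s))%N -> ~ acc n (rcons s j) x.
  have [|/existsNP[n] /not_implyP[_ nacc]] := nx j.
    by move=> jk; exists 0%N.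
  by exists n.
have [t [tk ts tC]] := sx (\max_(j < (k (size s)).+1) b j) I.
apply: (bP (t (size s)) (tk _)); exists t; split => // [i|j jb].
  rewrite size_rcons ltnS nth_rcons leq_eqVlt => /predU1P[->|is_].
    by rewrite ltnn eqxx.
  by rewrite is_; exact: ts.
apply: tC; apply: leq_trans jb _.
have tk' : (t (size s) < (k (size s)).+1)%N by rewrite ltnS.
exact: (leq_bigmax (F := fun j : 'I__ => b j) (Ordinal tk')).
Qed.

(** By König's lemma ([lim_acc_rcons]) the leftmost branch never dies. *)
Let next (x : X) (s : seq nat) : nat :=
  find (fun j => `[< lim_acc (rcons s j) x >]) (iota 0 (k (size s)).+1).

Let lim_acc_next s x : lim_acc s x -> lim_acc (rcons s (next x s)) x.
Proof.
move=> /lim_acc_rcons[j jk jx].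
have h : has (fun j => `[< lim_acc (rcons s j) x >]) (iota 0 (k (size s)).+1).
  by apply/hasP; exists j; [rewrite mem_iota|exact/asboolP].
have := nth_find 0%N h; rewrite nth_iota ?add0n; first by move/asboolP.
by rewrite -[X in (_ < X)%N](size_iota 0) -has_find.
Qed.

Let measurable_next s j : measurable [set x | next x s = j].
Proof.
suff : forall l p, measurable [set x |
    find (fun j => `[< lim_acc (rcons s j) x >]) l = p] by exact.
elim=> [p|a l IH [|p]] /=.
- have [->|p0] := eqVneq p 0%N.
    by rewrite [X in measurable X](_ : _ = setT)//; apply/seteqP; split.
  rewrite [X in measurable X](_ : _ = set0)//.
  by apply/seteqP; split => // x /= /esym/eqP; rewrite (negbTE p0).
- rewrite [X in measurable X](_ : _ = lim_acc (rcons s a))//.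
  by apply/seteqP; split=> x /=; case: asboolP.
- rewrite [X in measurable X](_ : _ = ~` lim_acc (rcons s a) `&` [set x |
    find (fun j => `[< lim_acc (rcons s j) x >]) l = p]).
    by apply: measurableI => //; exact: measurableC.
  apply/seteqP; split=> x /=; case: asboolP => //; first by move=> ? [].
    by move=> ? [].
  by move=> ? [_ ->].
Qed.

Let branch (x : X) (n : nat) : seq nat :=
  iter n (fun s => rcons s (next x s)) [::].

Let size_branch x n : size (branch x n) = n.
Proof. by elim: n => //= n IH; rewrite size_rcons IH. Qed.

Let measurable_branch n p : measurable [set x | branch x n = p].
Proof.
elim: n p => [|n IH] p /=.
  case: p => [|a p].
    by rewrite [X in measurable X](_ : _ = setT)//; apply/seteqP; split.
  by rewrite [X in measurable X](_ : _ = set0)//; apply/seteqP; split.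
case/lastP: p => [|p j].
  rewrite [X in measurable X](_ : _ = set0)//.
  by apply/seteqP; split => // x /= /(congr1 size); rewrite size_rcons.
rewrite [X in measurable X](_ : _ =
    [set x | branch x n = p] `&` [set x | next x p = j]).
  exact: measurableI.
apply/seteqP; split=> x /=; first by move=> /rcons_inj[<- <-].
by move=> [-> ->].
Qed.

Let leftmost (x : X) : baire := fun n => next x (branch x n).

Let nth_branch x n i : (i < n)%N -> nth 0%N (branch x n) i = leftmost x i.
Proof.
elim: n => // n IH; rewrite ltnS leq_eqVlt => /predU1P[->|ilt] /=.
  by rewrite nth_rcons size_branch ltnn eqxx.
by rewrite nth_rcons size_branch ilt IH.
Qed.

Let acc0E n : acc n [::] = approx k n.
Proof.
by apply/seteqP; split=> x; [move=> [t [? _ ?]]; exists t|move=> [t ? ?]; exists t].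
Qed.

(** Branches below [k] form a compact set: a point with, for each [n], a bounded branch meeting the
    first [n] conditions has one meeting them all. So the projection of the bounded scheme is the
    measurable set of such points. *)
Lemma bounded_selection : exists t : X -> baire,
  [/\ forall n, measurable (approx k n),
      measurable_fun setT t
    & forall x, (\bigcap_n approx k n) x -> forall n, C n (t x) x].
Proof.
exists leftmost; split=> [n||x].
- by rewrite -acc0E.
- apply: measurability => //.
  move=> _ [_ [n [i ->]] <-]; rewrite setTI.
  rewrite [X in measurable X](_ : _ = \bigcup_(p : seq nat)
     ([set x | branch x n = p] `&` [set x | next x p = i])).
    by apply: countable_bigcupT_measurable => // p; exact: measurableI.
  apply/seteqP; split=> x /=; first by exists (branch x n).
  by move=> [p _ [<-]].
- move=> x0 n.
  have branch_acc l : lim_acc (branch x l) x.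
    elim: l => [l _|l IH /=]; last exact: lim_acc_next.
    by rewrite acc0E; exact: x0.
  (* The first [D n] entries of the leftmost branch extend to some [t] meeting conditions 0 to [n],
     and [C n] sees no further entry. *)
  have [t [_ ts tC]] := branch_acc (D n) n.+1 I.
  rewrite (@detC _ _ t); first exact: tC.
  by move=> i iD; rewrite ts ?size_branch// nth_branch.
Qed.

End bound.

Lemma scheme_selection :
  ~ m.-negligible [set x | exists t, forall n, C n t x] ->
  exists (A : set X) (t : X -> baire), [/\ measurable A, 0 < m A,
    measurable_fun setT t & forall x, A x -> forall n, C n (t x) x].
Proof.
move=> nneg.
have [e e0 nsm] : exists2 e : R, (0 < e)%R &
    ~ small e [set x | exists t, forall n, C n t x].
  apply: contrapT => /forall2NP h; apply/nneg/negligible_small => e e0.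
  by case: (h e) => // /contrapT.
(* [pick] bounds one more coordinate of the branch while keeping the outer
   measure of the projection above [e] *)
have /choice[pick pickP] s : exists j, ~ small e (proj s) ->
    ~ small e (proj (rcons s j)).
  have [sm|/proj_rcons[j]] := pselect (small e (proj s)).
    by exists 0%N.
  by exists j.
pose pre n := iter n (fun s => rcons s (pick s)) [::].
pose k n := pick (pre n).
have size_pre n : size (pre n) = n.
  by elim: n => //= n IH; rewrite size_rcons IH.
have nth_pre n i : (i < n)%N -> nth 0%N (pre n) i = k i.
  elim: n => // n IH; rewrite ltnS leq_eqVlt => /predU1P[->|ilt] /=.
    by rewrite nth_rcons size_pre ltnn eqxx.
  by rewrite nth_rcons size_pre ilt IH.
have nsmall_pre n : ~ small e (proj (pre n)).
  elim: n => [sm|n IH /=]; last exact: pickP.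
  by apply: nsm; apply: small_subset sm => x [t Ct]; exists t.
have [t [mA mt tC]] := bounded_selection k.
have mI : measurable (\bigcap_n approx k n) by exact: bigcapT_measurable.
exists (\bigcap_n approx k n), t; split => //.
(* Otherwise [approx k n] would be a small cover of [proj (pre N)]: with [N] beyond the depths of
   the first [n] conditions, a branch may be replaced by 0 from [N] on, which puts it below [k]. *)
have approx_big n : e%:E < m (approx k n).
  rewrite ltNge; apply/negP => sm.
  pose N := \max_(j < n) D j.
  apply: (nsmall_pre N); exists (approx k n); split => // x [s bs sC].
  exists (fun i => if (i < N)%N then s i else 0%N) => [i|j jn].
    case: ifPn => // iN; rewrite -(nth_pre N)//.
    by apply: bs; rewrite size_pre.
  rewrite (@detC _ _ s)// => i iD.
  rewrite ifT// (leq_trans iD)//.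
  exact: (leq_bigmax (F := fun j : 'I_n => D j) (Ordinal jn)).
apply: (@lt_le_trans _ _ e%:E); first by rewrite lte_fin.
have cvgI : (m \o approx k) n @[n --> \oo] --> m (\bigcap_n approx k n).
  apply: nonincreasing_cvg_mu => //.
    by rewrite (le_lt_trans (probability_le1 _ _))// ltry.
  move=> i j ij; apply/subsetPset => x [s sk sC]; exists s => // l li.
  by apply: sC; exact: leq_trans ij.
rewrite -(cvg_lim _ cvgI)//; apply: lime_ge; first exact: cvgP cvgI.
by apply: nearW => n; exact/ltW/approx_big.
Qed.


End scheme.

(** One point of the Baire space carries two: here the point and its branch, later the codes of two
    laws. *)
Definition evens (t : baire) : baire := fun n => t n.*2.
Definition odds (t : baire) : baire := fun n => t n.*2.+1.

Lemma measurable_reindex (g : nat -> nat) :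
  measurable_fun setT ((fun t => t \o g) : baire -> baire).
Proof.
apply: measurability => // _ [_ [n [i ->]] <-]; rewrite setTI.
exact: measurable_cylinder (g n) i.
Qed.

Lemma measurable_selection (B : set (X * baire)) : measurable B ->
  ~ m.-negligible [set x | exists y, B (x, y)] ->
  exists (A : set X) (y : X -> baire), [/\ measurable A, 0 < m A,
    measurable_fun setT y & forall x, A x -> B (x, y x)].
Proof.
move=> /measurable_suslin[D [E [mE detE BE]]] nneg.
pose C n t := E n (evens t) (odds t).
have [|||A [t [mA A0 mt tC]]] := @scheme_selection (fun n => (D n).*2) C.
- by move=> n t; exact: mE.
- move=> n t t' tt'; apply: detE => i iD; split; apply: tt'.
    by rewrite ltn_double.
  by rewrite -ltn_uphalf_double uphalf_double.
- apply: contra_not nneg; apply: negligibleS => x [y /BE[s sE]].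
  exists (fun n => if odd n then s n./2 else y n./2) => n; rewrite /C.
  rewrite (_ : evens _ = y); last first.
    by apply/funext => i; rewrite /evens odd_double doubleK.
  rewrite (_ : odds _ = s)//.
  by apply/funext => i; rewrite /odds/= odd_double uphalf_double.
exists A, (evens \o t); split => //.
  exact: measurableT_comp (measurable_reindex double) mt.
by move=> x Ax; apply/BE; exists (odds (t x)) => n; exact: tC.
Qed.

End selection.

(** * Laws on a Polish space as images of the Baire space *)

Section polish_metric.
Context {R : realType} {d : measure_display} {W : polishType R d}.

(** The Polish structure in a form free of topology. The last field, that balls around the centers
    suffice to test measurability of a map, is how the Borel structure enters. *)
Record dense_metric := DenseMetric {
  dist : W -> W -> R;
  center : nat -> W;
  dist_eq0 : forall x y, dist x y = 0%R -> x = y;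
  distxx : forall x, dist x x = 0%R;
  distC : forall x y, dist x y = dist y x;
  dist_triangle : forall x y z, (dist x z <= dist x y + dist y z)%R;
  measurable_dist : forall x r, measurable [set y | (dist x y < r)%R];
  dense_center : forall x e, (0 < e)%R -> exists n, (dist (center n) x < e)%R;
  dist_complete : forall s : nat -> W,
    (forall e, (0 < e)%R -> exists N, forall m n, (N <= m)%N -> (N <= n)%N ->
       (dist (s m) (s n) < e)%R) ->
    exists l, forall e, (0 < e)%R -> exists N, forall n, (N <= n)%N ->
       (dist (s n) l < e)%R;
  measurable_fun_dist : forall d' (T : measurableType d') (g : T -> W),
    (forall n r, measurable (g @^-1` [set y | (dist (center n) y < r)%R])) ->
    measurable_fun setT g
}.

Lemma dense_metric_exists : inhabited dense_metric.
Proof.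
have [[D cD denseD] [dist [dist0 distC dist_tri nbhsE complete]]] :=
  @polishP R d W.
have openP (A : set W) : open A <-> forall x, A x ->
    exists2 e : R, (0 < e)%R & [set y | (dist x y < e)%R] `<=` A.
  rewrite openE; split=> [oA x /oA|h x /h]; first by move/nbhsE.
  by move/nbhsE.
have open_ball x r : open [set y | (dist x y < r)%R].
  apply/openP => y /= yr; exists (r - dist x y)%R; first by rewrite subr_gt0.
  by move=> z /= yz; rewrite (le_lt_trans (dist_tri _ y _))// -ltrBrDl.
have [f finj] : exists f : W -> nat, {in D &, injective f}.
  by move/countable_injP : cD.
pose a n := xget point [set y | D y /\ f y = n].
have denseD' x (e : R) : (0 < e)%R -> exists n, (dist (a n) x < e)%R.
  move=> e0; have [|y [/= xy Dy]] := denseD _ _ (open_ball x e).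
    by exists x; rewrite /= (dist0 x x).2.
  exists (f y); rewrite /a; case: xgetP => [z _ [Dz fz]|/(_ y)].
    by rewrite (finj z y)// ?inE// distC.
  by move=> /= h; exfalso; apply: h.
constructor; apply: (@DenseMetric dist a) => //.
- by move=> x y /dist0.
- by move=> x; apply/dist0.
- by move=> x r; rewrite borelE; apply: sub_sigma_algebra; exact: open_ball.
- move=> s /complete[l sl]; exists l => e e0.
  have /sl[N _ NP] : nbhs l [set y | (dist l y < e)%R] by apply/nbhsE; exists e.
  by exists N => n /NP /=; rewrite distC.
- move=> d' T g mg.
  apply: (@measurability _ _ _ _ _ _ open); first exact: borelE.
  move=> _ [A oA <-]; rewrite setTI.
  rewrite [X in measurable X](_ : _ = \bigcup_n \bigcup_(k in
      [set k | [set y | (dist (a n) y < k.+1%:R^-1)%R] `<=` A])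
      g @^-1` [set y | (dist (a n) y < k.+1%:R^-1)%R]).
    by apply: bigcupT_measurable => n; apply: bigcup_measurable => k _; exact: mg.
  apply/seteqP; split=> [t /= Agt|t [n _ [k /= kA /kA]]//].
  have [e e0 eA] := (openP A).1 oA _ Agt.
  have [|k] := @ltr_add_invr R 0%R (e / 2)%R; first by rewrite divr_gt0.
  rewrite add0r => ke.
  have [|n nt] := denseD' (g t) k.+1%:R^-1%R; first by rewrite invr_gt0.
  exists n => //; exists k => // y /= ny; apply: eA => /=.
  rewrite (le_lt_trans (dist_tri _ (a n) _))// (splitr e) distC ltrD//.
    exact: lt_trans ke.
  exact: lt_trans ke.
Qed.

End polish_metric.
Arguments dense_metric {R d} W.

(** * Cantor-set codes of bit sequences *)

Section ternary.
Context {R : realType}.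
Implicit Types (b : nat -> bool) (t : R).

(** The point of the Cantor set with digits [2 * b i]. *)
Definition ternarye b : \bar R :=
  \sum_(0 <= i <oo) ((b i)%:R * 2 / 3 ^+ i.+1)%:E.

Let term_ge0 b i : 0 <= ((b i)%:R * 2 / 3 ^+ i.+1 : R)%:E.
Proof. by rewrite lee_fin divr_ge0// mulr_ge0. Qed.

Lemma ternarye_le1 b : ternarye b <= 1.
Proof.
apply: lime_le; first by apply: is_cvg_nneseries => i _ _; exact: term_ge0.
apply: nearW => n; rewrite sumEFin lee_fin.
(* The partial sum when all bits are 1. *)
apply: (@le_trans _ _ (1 - (3 ^+ n)^-1)%R); last by rewrite gerBl invr_ge0.
elim: n => [|n IH]; first by rewrite big_geq// invr1 subrr.
rewrite big_nat_recr//= exprS.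
have -> : (1 - (3 * 3 ^+ n)^-1 = (1 - (3 ^+ n)^-1) + 2 / (3 * 3 ^+ n) :> R)%R.
  by field.
by rewrite lerD// ler_pM2r ?invr_gt0// ler_piMl//; case: (b n).
Qed.

Lemma ternarye_fin b : ternarye b \is a fin_num.
Proof.
rewrite ge0_fin_numE; last by apply: nneseries_ge0 => i _ _; exact: term_ge0.
by rewrite (le_lt_trans (ternarye_le1 b))// ltry.
Qed.

Definition ternary b : R := fine (ternarye b).

Lemma ternary_ge0 b : (0 <= ternary b)%R.
Proof. by apply/fine_ge0/nneseries_ge0 => i _ _; exact: term_ge0. Qed.

Lemma ternary_le1 b : (ternary b <= 1)%R.
Proof. by rewrite -lee_fin fineK ?ternarye_fin// ternarye_le1. Qed.

Lemma ternary_rec b :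
  ternary b = (((b 0%N)%:R * 2 + ternary (b \o succn)) / 3)%R.
Proof.
apply: EFin_inj; rewrite /ternary fineK ?ternarye_fin//.
rewrite {1}/ternarye nneseries_recl//.
rewrite -(@nneseries_addn _ (fun i => ((b i)%:R * 2 / 3 ^+ i.+1)%:E) 1)//.
rewrite mulrDl EFinD expr1; congr (_ + _).
rewrite mulrC EFinM fineK ?ternarye_fin// -nneseriesZl//.
by apply: eq_eseriesr => i _; rewrite -EFinM addn1 /= !exprS; congr EFin; field.
Qed.

(** The value is at most 1/3 or at least 2/3 according to the first bit, so any threshold inside the
    gap, such as 1/2, reads that bit. The gap is the reason for base 3: binary expansions are
    ambiguous. *)
Definition tail_digits t : R := if (2^-1 <= t)%R then (3 * t - 2)%R else (3 * t)%R.
Definition digit (n : nat) t : bool := (2^-1 <= iter n tail_digits t)%R.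

Lemma digit0_ternary b : (2^-1 <= ternary b)%R = b 0%N.
Proof.
have := ternary_ge0 (b \o succn); have := ternary_le1 (b \o succn).
rewrite [ternary b]ternary_rec; case: (b 0%N) => /= h1 h0; first by lra.
by apply/negbTE; rewrite -ltNge; lra.
Qed.

Lemma tail_digits_ternary b : tail_digits (ternary b) = ternary (b \o succn).
Proof.
rewrite /tail_digits digit0_ternary [in LHS]ternary_rec.
by case: (b 0%N) => /=; field.
Qed.

Lemma digit_ternary n b : digit n (ternary b) = b n.
Proof.
rewrite /digit; elim: n b => [|n IH] b; first exact: digit0_ternary.
by rewrite iterSr tail_digits_ternary IH.
Qed.

Lemma measurable_tail_digits : measurable_fun setT tail_digits.
Proof.
apply: measurable_fun_ifT => //.
  exact: (measurable_fun_ler (f := fun=> 2^-1%R) (g := id)).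
by apply: measurable_funB => //; exact: measurable_funM.
Qed.

Lemma measurable_digit n : measurable [set t | digit n t].
Proof.
have mit : measurable_fun setT (iter n tail_digits).
  elim: n => [|n IH]; first exact: measurable_id.
  exact: (measurableT_comp measurable_tail_digits IH).
have -> : [set t | digit n t] = setT `&` (iter n tail_digits) @^-1` `[2^-1%R, +oo[.
  by rewrite setTI; apply/seteqP; split => t; rewrite /= in_itv/= andbT.
exact: mit.
Qed.

Lemma measurable_ternary d (T : measurableType d) (b : nat -> T -> bool) :
  (forall n, measurable [set x | b n x]) ->
  measurable_fun setT (fun x => ternary (b ^~ x)).
Proof.
move=> mb; apply: (measurableT_comp (f := fine)) => //.
apply: (ge0_emeasurable_sum (P := xpredT)) => // n _.
apply/measurable_EFinP; apply: measurable_funM => //.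
apply: measurable_funM => //.
rewrite (_ : (fun x => _) = (\1_[set x | b n x])%R); first exact: measurable_indic.
apply/funext => x; rewrite indicE; congr ((nat_of_bool _)%:R)%R.
by apply/idP/idP; rewrite inE.
Qed.

End ternary.

(** * Borel embedding of a Polish space into the real line *)

Section real_embedding.
Context {R : realType} {d : measure_display} {W : polishType R d}.
Variable M : dense_metric W.

Local Notation rho := (dist M).
Local Notation a := (center M).
Let h (n : nat) : R := n.+1%:R^-1%R.

Let h_gt0 n : (0 < h n)%R. Proof. by rewrite invr_gt0. Qed.

Let h_le m n : (m <= n)%N -> (h n <= h m)%R.
Proof. by move=> mn; rewrite lef_pV2 ?posrE// ler_nat. Qed.

Let h_lt (e : R) : (0 < e)%R -> exists n, (h n < e)%R.
Proof. by move=> /ltr_add_invr[n]; rewrite add0r; exists n. Qed.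

Let dist_ge0 x y : (0 <= rho x y)%R.
Proof.
have := dist_triangle M x y x; rewrite distxx (distC M y x) => H; lra.
Qed.

(** The [pickle (n, i)]-th digit tells whether [w] is within [h n] of the
    [i]-th center, so that the first such [i] for each [n] recovers [w]. *)
Let bit (m : nat) (w : W) : bool :=
  let p := unpair m in (rho (a p.2) w < h p.1)%R.

Definition real_code (w : W) : R := ternary (bit ^~ w).

Let first (n : nat) (t : R) : nat :=
  xget 0%N [set i | digit (pickle (n, i)) t /\
    forall j, (j < i)%N -> ~~ digit (pickle (n, j)) t].

(** The centers read from [t] are Cauchy at an explicit rate. This is a Borel condition met by every
    code of a point [w], since the centers read at levels [m <= n] are both within [h m] of [w]. *)
Let good : set R := [set t | forall p : nat * nat, (p.1 <= p.2)%N ->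
  (rho (a (first p.1 t)) (a (first p.2 t)) < h p.1 + h p.1)%R].

Definition real_decode (t : R) : W :=
  if `[< good t >] then
    xget (a 0%N) [set l | forall e, (0 < e)%R -> exists N, forall n, (N <= n)%N ->
       (rho (a (first n t)) l < e)%R]
  else a 0%N.

Lemma measurable_real_code : measurable_fun setT real_code.
Proof.
apply: measurable_ternary => m.
exact: measurable_dist.
Qed.

Let measurable_first n i : measurable [set t | first n t = i].
Proof.
pose F i := [set t | digit (R := R) (pickle (n, i)) t] `&`
    \bigcap_(j in `I_i) ~` [set t | digit (pickle (n, j)) t].
have mF j : measurable (F j).
  apply: measurableI; first exact: measurable_digit.
  by apply: bigcap_measurableType => k _; apply: measurableC; exact: measurable_digit.
have FP t j : F j t -> first n t = j.
  move=> [dj nj]; rewrite /first; case: xgetP => [k _ [dk nk]|/(_ j)[]].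
    have [kj|jk|//] := ltngtP k j.
      by have := nj k kj; rewrite /= dk.
    by have := nk j jk; rewrite dj.
  by split => // k kj; apply/negP; exact: nj.
have firstP t : (exists j, F j t) \/ first n t = 0%N.
  rewrite /first; case: xgetP => [k _ [dk nk]|_]; last by right.
  by left; exists k; split => // j /nk /negP.
(* The second piece accounts for the default: without any digit at level [n], [first] is 0. *)
rewrite [X in measurable X](_ : _ = F i `|`
    (if i == 0%N then ~` \bigcup_j F j else set0)).
  apply: measurableU => //; case: ifP => // _; apply: measurableC.
  exact: bigcupT_measurable.
apply/seteqP; split => t /=.
  move=> ti; case: (firstP t) => [[j Fj]|f0].
    by left; rewrite -ti (FP _ _ Fj).
  have [Ft|nFt] := pselect ((\bigcup_j F j) t); last by right; rewrite -ti f0 eqxx.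
  by left; case: Ft => j _ Fj; rewrite -ti (FP _ _ Fj).
move=> [/FP//|]; case: eqP => // -> nF.
by case: (firstP t) => // -[j Fj]; exfalso; apply: nF; exists j.
Qed.

Let measurable_good : measurable good.
Proof.
rewrite (_ : good = \bigcap_(m : nat) \bigcap_(n in [set n | (m <= n)%N])
  ~` (\bigcup_(i : nat) \bigcup_(j in [set j | ~~ (rho (a i) (a j) < h m + h m)%R])
    ([set t | first m t = i] `&` [set t | first n t = j]))).
  apply: bigcapT_measurable => m; apply: bigcap_measurableType => n _.
  apply: measurableC; apply: bigcupT_measurable => i.
  by apply: bigcup_measurable => j _; exact: measurableI.
apply/seteqP; split => t.
  move=> gt m _ n /= mn [i _ [j /= /negP nij [ti tj]]]; apply: nij.
  by rewrite -ti -tj; exact: (gt (m, n)).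
move=> gt [m n] /= mn; apply: contrapT => /negP nlt.
by apply: (gt m I n mn); exists (first m t) => //; exists (first n t).
Qed.

Let decode_close t n : good t ->
  (rho (a (first n t)) (real_decode t) <= h n + h n)%R.
Proof.
move=> gt; rewrite /real_decode (asboolT gt).
case: xgetP => [l _ lP|nol].
  apply/ler_addgt0Pr => e e0; have [N NP] := lP e e0.
  apply: le_trans (dist_triangle M _ (a (first (maxn n N) t)) _) _.
  apply: lerD; last by apply/ltW/NP; rewrite leq_maxr.
  by apply/ltW/(gt (n, maxn n N)); rewrite leq_maxl.
exfalso.
have [e e0|l lP] := @dist_complete _ _ _ M (fun n => a (first n t)); last first.
  exact: nol lP.
have [N Ne] := h_lt (divr_gt0 e0 (ltr0Sn R 3)).
exists N => i j Ni Nj.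
apply: le_lt_trans (dist_triangle M _ (a (first N t)) _) _.
have := gt (N, i) Ni; have := gt (N, j) Nj; rewrite /= (distC M (a (first i t))).
move=> H1 H2; lra.
Qed.

(** On [good], the decoded point is within [h n + h n] of the center read at level [n], so it lies
    in an open ball exactly when some level certifies it; off [good] it is constant. *)
Lemma measurable_real_decode : measurable_fun setT real_decode.
Proof.
apply: (@measurable_fun_dist _ _ _ M) => j r.
have mb : measurable (good `&` \bigcup_n \bigcup_(i in
    [set i | (rho (a j) (a i) + (h n + h n) < r)%R]) [set t | first n t = i]).
  apply: measurableI => //; apply: bigcupT_measurable => n.
  exact: bigcup_measurable.
have mc : measurable (if (rho (a j) (a 0%N) < r)%R then ~` good else set0).
  by case: ifP => // _; exact: measurableC.
suff -> : real_decode @^-1` [set y | (rho (a j) y < r)%R] =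
    (good `&` \bigcup_n \bigcup_(i in
      [set i | (rho (a j) (a i) + (h n + h n) < r)%R]) [set t | first n t = i])
    `|` (if (rho (a j) (a 0%N) < r)%R then ~` good else set0).
  exact: measurableU.
apply/seteqP; split => t /=.
  have [gt|ngt] := pselect (good t); last first.
    by rewrite /real_decode asboolF// => ->; right.
  move=> tr; left; split => //.
  (* A quarter, because passing from the decoded point to the center costs [h n + h n] and the
     certificate asks for as much again. *)
  have e0 : (0 < (r - rho (a j) (real_decode t)) / 4)%R.
    by rewrite divr_gt0// subr_gt0.
  have [n ne] := h_lt e0; exists n => //; exists (first n t) => //=.
  have := decode_close n gt.
  have := dist_triangle M (a j) (real_decode t) (a (first n t)).
  rewrite (distC M (real_decode t)) => H1 H2; lra.
move=> [[gt [n _ [i /= ri ti]]]|]; last first.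
  by case: ifP => // jr ngt; rewrite /real_decode asboolF.
have := decode_close n gt; rewrite ti.
have := dist_triangle M (a j) (a i) (real_decode t).
by move=> H1 H2; lra.
Qed.

Lemma real_codeK : cancel real_code real_decode.
Proof.
move=> w; set t := real_code w.
have firstP n : (rho (a (first n t)) w < h n)%R.
  rewrite /first; case: xgetP => [i _ [+ _]|].
    by rewrite digit_ternary /bit unpairK.
  have ex : exists i : nat, digit (pickle (n, i)) t.
    have [i iw] := dense_center M w (h_gt0 n).
    by exists i; rewrite digit_ternary /bit unpairK.
  move=> /(_ (ex_minn ex)) []; case: ex_minnP => i di mini; split => // j ji.
  by apply/negP => /mini; rewrite leqNgt ji.
have gt : good t.
  move=> [m n] /= mn; apply: le_lt_trans (dist_triangle M _ w _) _.
  rewrite (distC M w) ltrD//.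
  exact: lt_le_trans (firstP n) (h_le mn).
apply: (@dist_eq0 _ _ _ M); apply/eqP; rewrite eq_le dist_ge0 andbT.
apply/ler_addgt0Pr => e e0; rewrite add0r.
have [n ne] := h_lt (divr_gt0 e0 (ltr0Sn R 2)).
apply: le_trans (dist_triangle M _ (a (first n t)) _) _.
have := decode_close n gt; rewrite distC => H1; have H2 := firstP n; lra.
Qed.

End real_embedding.

(** * Identification of laws, and quantile functions *)

Lemma probability_eq_pi_system d (T : measurableType d) (R : realType)
    (G : set_system T) (m1 m2 : probability T R) :
  measurable = <<s G >> -> setI_closed G ->
  (forall A, G A -> m1 A = m2 A) -> measure_eq m1 m2.
Proof.
(* Uniqueness of measures wants an exhaustion of the space by generators; the whole space is
   adjoined to serve as one. *)
move=> mG GI m12; pose G' := G `|` [set setT].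
have mG' : measurable = <<s G' >>.
  rewrite mG; apply/seteqP; split; apply: smallest_sub.
  - exact: smallest_sigma_algebra.
  - by apply: subset_trans (@sub_sigma_algebra _ _ _) => A; left.
  - exact: smallest_sigma_algebra.
  - move=> A [GA|->]; first exact: sub_sigma_algebra.
    by rewrite -mG; exact: measurableT.
move=> A mA; apply: (measure_unique G' (fun=> setT)) => //.
- move=> B C [GB|->] [GC|->]; rewrite ?setIT ?setTI; [|by left|by left|by right].
  by left; exact: GI.
- by right.
- by apply/seteqP; split => // x _; exists 0%N.
- move=> B [/m12//|->].
  exact: etrans (probability_setT m1) (esym (probability_setT m2)).
- by move=> _; rewrite -ge0_fin_numE// fin_num_measure.
Qed.

Lemma probability_eq_cdf (R : realType)
    (m1 m2 : probability (measurableTypeR R) R) :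
  (forall y, m1 `]-oo, y]%classic = m2 `]-oo, y]%classic) -> measure_eq m1 m2.
Proof.
move=> m12; apply: (@probability_eq_pi_system _ (measurableTypeR R) R (@ocitv R)) => //.
  exact: ocitvI.
move=> _ [[a b] _ <-] /=.
have [ab|ba] := leP a b; last first.
  by rewrite set_itv_ge ?measure0// bnd_simp -leNgt ltW.
have -> : `]a, b]%classic = `]-oo, b] `\` `]-oo, a] :> set R.
  by rewrite -[RHS]setCK setCD setCitvl setUC -[LHS]setCK setCitv.
rewrite !measureD ?setIidr//; try exact: subset_itvl.
- by congr (_ - _); exact: m12.
- by rewrite -ge0_fin_numE// fin_num_measure.
- by rewrite -ge0_fin_numE// fin_num_measure.
Qed.

Lemma measurable_pprobability d d' (T : measurableType d)
    (W : measurableType d') (R : realType) (f : T -> probability W R) :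
  (forall B, measurable B -> measurable_fun setT (fun t => f t B)) ->
  measurable_fun setT (f : T -> pprobability W R).
Proof.
move=> mf; apply: (measurability (@pset _ W R : set (set (pprobability W R)))) => //.
move=> _ -[_ [r r01] [B mB <-]] <-.
by apply: emeasurable_fun_infty_o => //; exact: mf.
Qed.

Lemma measurable_pprobability_eval d d' (T : measurableType d)
    (W : measurableType d') (R : realType) (f : T -> probability W R) B :
  measurable_fun setT (f : T -> pprobability W R) -> measurable B ->
  measurable_fun setT (fun t => f t B).
Proof.
move=> mf mB.
exact: (measurable_kernel (kprobability mf) B mB).
Qed.

(** Membership is prescribed on the open interval only, since a quantile function may be infinite at
    0 and 1. The measure of [A] in the unit interval is squeezed between those of []0, p[] and of
    [[0, p]] with the point 1 added. *)
Lemma uniform01_initial (R : realType) (A : set R) (p : R) :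
  measurable A -> (0 <= p <= 1)%R ->
  (forall t, (0 < t < 1)%R -> (A t <-> (t <= p)%R)) ->
  uniform_prob (@ltr01 R) A = p%:E.
Proof.
move=> mA /andP[p0 p1] AE.
have -> : uniform_prob (@ltr01 R) A = lebesgue_measure (A `&` `[0%R, 1%R]%classic).
  rewrite /uniform_prob integral_uniform_pdf.
  rewrite (eq_integral (cst 1)); last first.
    by move=> x /set_mem[_ /=]; rewrite in_itv /= /uniform_pdf => ->; rewrite subr0 invr1.
  by rewrite integral_cst ?mul1e//; exact: measurableI.
apply/eqP; rewrite eq_le; apply/andP; split.
  apply: (@le_trans _ _ (lebesgue_measure (`[0%R, p]%classic `|` [set 1%R] : set R))).
    apply: le_measure; rewrite ?inE; [exact: measurableI|exact: measurableU|].
    move=> t [At /=]; rewrite !in_itv/= => /andP[t0 t1].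
    have [->|t1'] := eqVneq t 1%R; first by right.
    have [->|t0'] := eqVneq t 0%R; first by left; rewrite lexx.
    left; rewrite t0/=; apply/AE => //.
    by rewrite !lt_neqAle eq_sym t0' t0 t1' t1.
  apply: le_trans (measureU2 _ _ _) _ => //.
  rewrite [X in _ + X <= _](lebesgue_measure_set1 1%R) adde0.
  rewrite [X in X <= _](lebesgue_measure_itv `[0%R, p]%R) /=.
  by case: ifP => //; rewrite ?sube0// lee_fin.
apply: (@le_trans _ _ (lebesgue_measure (`]0%R, p[%classic : set R))).
  rewrite [X in _ <= X](lebesgue_measure_itv `]0%R, p[%R) /= lte_fin.
  by case: ltP => [_|]; [rewrite sube0|rewrite lee_fin].
apply: le_measure; rewrite ?inE//; first exact: measurableI.
move=> t /=; rewrite !in_itv/= => /andP[t0 tp]; split.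
  by apply/AE; [rewrite t0 (lt_le_trans tp)|exact: ltW].
by rewrite (ltW t0) (ltW (lt_le_trans tp p1)).
Qed.

Section quantile.
Context {R : realType}.

Definition grid (p : nat) : rat * rat := odflt (0, 0)%R (unpickle p).

Lemma gridK q : grid (pickle q) = q.
Proof. by rewrite /grid pickleK. Qed.

(** The nondecreasing left-continuous function of [t] whose graph lies above
    the points [(q, r)] of the grid selected by [y]. *)
Definition quantile_term (y : baire) (t : R) (p : nat) : \bar R :=
  if (y p != 0%N) && (ratr (grid p).1 < t)%R then (ratr (grid p).2)%:E else -oo.

Definition quantile (y : baire) (t : R) : \bar R := esups (quantile_term y t) 0%N.

Lemma quantile_le y t b : quantile y t <= b <->
  forall p, y p != 0%N -> (ratr (grid p).1 < t)%R -> (ratr (grid p).2)%:E <= b.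
Proof.
split=> [qb p yp pt|h].
  apply: le_trans qb; apply: ereal_sup_ubound; exists p => //.
  by rewrite /quantile_term yp pt.
apply: ge_ereal_sup => _ [p _ <-]; rewrite /quantile_term.
by case: ifPn => [/andP[yp pt]|_]; [exact: h|rewrite leNye].
Qed.

Lemma measurable_quantile :
  measurable_fun setT (fun yt : baire * R => quantile yt.1 yt.2).
Proof.
apply: (measurable_fun_esups (f := fun p (yt : baire * R) =>
  quantile_term yt.1 yt.2 p)) => p.
apply: measurable_fun_ifT => //.
apply: measurable_and.
  apply: (measurable_fun_bool false); rewrite setTI.
  rewrite [X in measurable X](_ : _ = fst @^-1` cylinder p 0%N).
    rewrite -[X in measurable X]setTI; apply: measurable_fst => //.
    exact: measurable_cylinder.
  by apply/seteqP; split => -[y t] /=; [move=> /negbFE/eqP|move=> ->; rewrite eqxx].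
apply: measurable_fun_ltr => //; exact: measurable_snd.
Qed.

(** The Galois connection that defines the generalized inverse of [F]. A pair [(q, r)] with
    [F r < q] forces the inverse above [r] at every [t > q]. Right-continuity reduces [t <= F b] to
    [t <= F c] for [c > b]; a failure there leaves room for rationals [r] between [b] and [c], and
    [q] between [F r] and [t]. *)
Lemma quantile_cdf (F : R -> \bar R) y :
  {homo F : a b / (a <= b)%R >-> a <= b} ->
  (forall a l, (forall b, (a < b)%R -> l <= F b) -> l <= F a) ->
  (forall p, y p != 0%N <-> F (ratr (grid p).2) < (ratr (grid p).1)%:E) ->
  forall t b, quantile y t <= b%:E <-> t%:E <= F b.
Proof.
move=> ndF rcF yE t b; rewrite quantile_le; split=> [h|tb p /yE Fp pt].
  apply: rcF => c bc; rewrite leNgt; apply/negP => Fct.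
  have [r rbc] := rat_in_itvoo bc; rewrite in_itv/= in rbc.
  have /andP[br rc] := rbc.
  have [q /andP[Fq qt]] : exists q : rat, (F (ratr r) < (ratr q)%:E) && (ratr q < t)%R.
    have Frt : F (ratr r) < t%:E := le_lt_trans (ndF _ _ (ltW rc)) Fct.
    case: (F (ratr r)) Frt => [f| |] //.
      rewrite lte_fin => /rat_in_itvoo[q]; rewrite in_itv/= => /andP[fq qt].
      by exists q; rewrite lte_fin fq.
    have t1 : (t - 1 < t)%R by lra.
    have [q] := rat_in_itvoo t1; rewrite in_itv/= => /andP[_ qt] _.
    by exists q; rewrite ltNyr.
  have := h (pickle (q, r)); rewrite gridK /= => /(_ _ qt).
  rewrite lee_fin leNgt br => H.
  by have /H : y (pickle (q, r)) != 0%N by apply/yE; rewrite gridK.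
rewrite lee_fin leNgt; apply/negP => br.
have := le_lt_trans (le_trans tb (ndF _ _ (ltW br))) Fp.
by rewrite lte_fin => /(lt_trans pt); rewrite ltxx.
Qed.

End quantile.

Section law_code.
Context {R : realType} {d : measure_display} {W : polishType R d}.
Variable M : dense_metric W.

Let sample (yt : baire * R) : W := real_decode M (fine (quantile yt.1 yt.2)).

Let measurable_sample : measurable_fun setT sample.
Proof.
apply: (measurableT_comp (measurable_real_decode M)).
apply: (measurableT_comp (f := fine)) => //.
exact: measurable_quantile.
Qed.

Definition sample_path (y : baire) (t : measurableTypeR R) : W := sample (y, t).

Let measurable_sample_path y : measurable_fun setT (sample_path y).
Proof. exact: measurableT_comp measurable_sample (pair1_measurable y). Qed.

Let sample_rv y : {mfun measurableTypeR R >-> W} :=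
  HB.pack (sample_path y)
    (isMeasurableFun.Build _ _ _ _ (sample_path y) (measurable_sample_path y)).

(** Inverse transform sampling: a uniform variable is sent through the quantile function coded by
    [y], then decoded into [W]. As [fine] sends infinite quantiles to 0, every [y] codes a law. *)
Definition law_of (y : baire) : probability W R :=
  distribution (uniform_prob (@ltr01 R)) (sample_rv y).

Lemma measurable_law_of : measurable_fun setT (law_of : baire -> pprobability W R).
Proof.
apply: measurable_pprobability => B mB.
have mS : measurable (sample @^-1` B).
  by rewrite -[X in measurable X]setTI; exact: measurable_sample.
have := measurable_fun_xsection (uniform_prob (@ltr01 R)) mS.
apply: eq_measurable_fun => y _ /=; congr (uniform_prob _ _).
by apply/seteqP; split => t; rewrite /xsection /= inE.
Qed.

Let code_rv : {mfun W >-> measurableTypeR R} :=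
  HB.pack (real_code M : W -> measurableTypeR R)
    (isMeasurableFun.Build _ _ W (measurableTypeR R) (real_code M)
       (measurable_real_code M)).

Let code_mfun : {mfun W >-> R} :=
  HB.pack (real_code M)
    (isMeasurableFun.Build _ _ W R (real_code M) (measurable_real_code M)).

(** The code is read off the distribution function [F] of the image of [m] by [real_code]; sampling
    restores this image, and decoding restores [m] by [real_codeK]. *)
Lemma law_of_surj (m : probability W R) : exists y, measure_eq (law_of y) m.
Proof.
pose nu : probability (measurableTypeR R) R := distribution m code_rv.
pose F (b : R) := nu `]-oo, b]%classic.
have ndF : {homo F : a b / (a <= b)%R >-> a <= b}.
  by move=> a b ab; apply: le_measure; rewrite ?inE//; exact: subitvPr.
have F1 b : F b <= 1 by exact: probability_le1.
pose y : baire := fun p => nat_of_bool (F (ratr (grid p).2) < (ratr (grid p).1)%:E)%E.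
have qF : forall t b, quantile y t <= b%:E <-> t%:E <= F b.
  apply: quantile_cdf => // [a l la|p]; last by rewrite /y; case: (_ < _).
  have cF : F b @[b --> a^'+] --> F a.
    exact: (@cdf_right_continuous _ _ _ m code_mfun).
  rewrite -(cvg_lim _ cF)//; apply: lime_ge; first exact: cvgP cF.
  by apply: filterS (nbhs_right_gt a) => b; exact: la.
exists y => B mB.
pose g (t : R) : R := fine (quantile y t).
have mg : measurable_fun setT g.
  apply: (measurableT_comp (f := fine)) => //.
  exact: measurableT_comp measurable_quantile (pair1_measurable y).
pose G : {mfun measurableTypeR R >-> measurableTypeR R} :=
  HB.pack (g : measurableTypeR R -> measurableTypeR R)
    (isMeasurableFun.Build _ _ (measurableTypeR R) (measurableTypeR R) g mg).
have GF : measure_eq (distribution (uniform_prob (@ltr01 R)) G) nu.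
  apply: probability_eq_cdf => b.
  have Fb : F b = (fine (F b))%:E by rewrite fineK// fin_num_measure.
  rewrite -[RHS]/(F b) Fb /distribution/= /pushforward.
  apply: uniform01_initial.
  - by rewrite -[X in measurable X]setTI; exact: (mg measurableT _ (measurable_itv _)).
  - by rewrite -!lee_fin -Fb F1 measure_ge0.
  - move=> t /andP[t0 t1]; rewrite -lee_fin -Fb -qF /= in_itv/= /g.
    (* [fine] is faithful on finite values only; inside the unit interval the quantile is finite
       because [F] tends to 0 and 1. *)
    suff qfin : quantile y t \is a fin_num by rewrite -lee_fin fineK.
    apply/fin_numPlt/andP; split.
      have [c Fct] : exists c, F c < t%:E.
        apply: contrapT => /forallNP h.
        have cF : F @ -oo%R --> 0 by exact: (@cvg_cdfNy0 _ _ _ m code_mfun).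
        have : t%:E <= 0.
          rewrite -(cvg_lim _ cF)//; apply: lime_ge; first exact: cvgP cF.
          by apply: nearW => c; rewrite leNgt; apply/negP/h.
        by rewrite lee_fin leNgt t0.
      apply: (@lt_trans _ _ c%:E); first exact: ltNyr.
      by rewrite ltNge; apply/negP => /qF; rewrite leNgt Fct.
    have [c tFc] : exists c, t%:E <= F c.
      apply: contrapT => /forallNP h.
      have cF : F @ +oo%R --> 1 by exact: (@cvg_cdfy1 _ _ _ m code_mfun).
      have : 1 <= t%:E.
        rewrite -(cvg_lim _ cF)//; apply: lime_le; first exact: cvgP cF.
        by apply: nearW => c; rewrite ltW// ltNge; apply/negP/h.
      by rewrite lee_fin leNgt t1.
    by apply: (@le_lt_trans _ _ c%:E); [apply/qF|exact: ltry].
transitivity (nu (real_decode M @^-1` B)).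
  apply: (GF (real_decode M @^-1` B)).
  by rewrite -[X in measurable X]setTI; exact: measurable_real_decode.
congr (m _); apply/seteqP; split => w /=; by rewrite real_codeK.
Qed.

End law_code.

(** * Joint laws and conditional laws *)

Section eq_measure.
Context {R : realType} {d : measure_display} {T : measurableType d}.
Implicit Types m : measure T R.

Lemma negligible_dominated m1 m2 :
  (forall A, measurable A -> m2 A = 0 -> m1 A = 0) ->
  forall N, m2.-negligible N -> m1.-negligible N.
Proof. by move=> m12 N [A [mA A0 NA]]; exists A; split => //; exact: m12. Qed.

Lemma ae_dominated m1 m2 (P : T -> Prop) :
  (forall A, measurable A -> m2 A = 0 -> m1 A = 0) ->
  (\forall x \ae m2, P x) -> \forall x \ae m1, P x.
Proof. by move=> m12; apply: negligible_dominated. Qed.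

Lemma integral_measure_eq m1 m2 (f : T -> \bar R) : measure_eq m1 m2 ->
  \int[m1]_x f x = \int[m2]_x f x.
Proof. by move=> m12; apply: eq_measure_integral => A mA _; exact: m12. Qed.

Lemma integrable_measure_eq m1 m2 (f : T -> \bar R) : measure_eq m1 m2 ->
  m2.-integrable setT f -> m1.-integrable setT f.
Proof.
move=> m12 /integrableP[mf foo]; apply/integrableP; split => //.
by rewrite (integral_measure_eq _ m12).
Qed.

End eq_measure.

Lemma mnormalize_full d (T : measurableType d) (R : realType)
    (mu : measure T R) (P : probability T R) (A : set T) :
  mu setT = 1 -> mnormalize mu P A = mu A.
Proof.
move=> muT; rewrite /mnormalize muT ifF; last by rewrite onee_eq0.
by rewrite /= invr1 mule1.
Qed.

Section joint_law.
Context {R : realType} {dX dW : measure_display}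
  {X : measurableType dX} {W : measurableType dW}.
Implicit Types (m : probability X R) (k : X -> probability W R)
  (P : probability (X * W)%type R).

Lemma measurable_cond_integral k (h : X * W -> \bar R) :
  measurable_fun setT (k : X -> pprobability W R) ->
  measurable_fun setT h -> (forall z, 0 <= h z) ->
  measurable_fun setT (fun x => \int[k x]_y h (x, y)).
Proof.
move=> mk mh h0.
exact: (measurable_fun_integral_finite_kernel h (kprobability mk) h0 mh).
Qed.

(** The law of [(x, Y)] with [Y] drawn from [k x]; its mixture over [m] is the joint law. *)
Let slice k (x : X) : giry (X * W)%type R :=
  giry_map (pair1_measurable x) (k x : giry W R).

Let measurable_slice k :
  measurable_fun setT (k : X -> pprobability W R) ->
  measurable_fun setT (slice k).
Proof.
move=> mk; apply: measurable_giry_codensity => // A mA.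
have := @measurable_fun_xsection_finite_kernel _ _ _ _ _ (kprobability mk) A.
move=> /(_ (mem_set mA)); apply: eq_measurable_fun => x _ /=.
by congr (k x _); apply/seteqP; split => y; rewrite /xsection/= inE.
Qed.

Let bind m k (mk : measurable_fun setT (k : X -> pprobability W R)) :
  giry (X * W)%type R := giry_bind (m : giry X R) (measurable_slice mk).

Let integral_bind m k mk (h : X * W -> \bar R) :
  measurable_fun setT h -> (forall z, 0 <= h z) ->
  \int[@bind m k mk]_z h z = \int[m]_x \int[k x]_y h (x, y).
Proof.
move=> mh h0; rewrite -[LHS]/(giry_int _ h) giry_int_bind//.
apply: eq_integral => x _; rewrite giry_int_map//.
Qed.

Let bindE m k mk A : measurable A ->
  @bind m k mk A = \int[m]_x k x (xsection A x).
Proof.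
move=> mA.
transitivity (\int[@bind m k mk]_z (\1_A z)%:E).
  by rewrite integral_indic// setIT.
rewrite integral_bind//; last exact/measurable_EFinP/measurable_indic.
apply: eq_integral => x _.
transitivity (\int[k x]_y (\1_(xsection A x) y)%:E).
  apply: eq_integral => y _; congr (_ %:E).
  by rewrite !indicE mem_xsection.
by rewrite integral_indic ?setIT//; exact: measurable_xsection.
Qed.

Let bindT m k mk : @bind m k mk setT = 1.
Proof.
rewrite bindE// (eq_integral (cst 1)).
  by rewrite integral_cst// mul1e; exact: probability_setT.
move=> x _; rewrite (_ : xsection setT x = setT); first exact: probability_setT.
by apply/seteqP; split => // y _; rewrite /xsection/= inE.
Qed.

(** The mass is already 1 by [bindT]; normalizing only packages the measure as a [probability]. *)
Let jointlaw m k (mk : measurable_fun setT (k : X -> pprobability W R))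
  : probability (X * W)%type R := mnormalize (bind m mk) point.

Let jointlawE m k mk A : @jointlaw m k mk A = @bind m k mk A.
Proof. exact: mnormalize_full (bindT m mk). Qed.

Let is_joint_jointlaw m k mk : is_joint_law (@jointlaw m k mk) m k.
Proof.
move=> A B mA mB; rewrite jointlawE bindE; last exact: measurableX.
rewrite [RHS]integral_mkcond; apply: eq_integral => x _.
rewrite patchE; case: ifPn => xA; first by rewrite in_xsectionX.
by rewrite notin_xsectionX ?measure0.
Qed.

Lemma joint_law_exists m k :
  measurable_fun setT (k : X -> pprobability W R) ->
  exists P, is_joint_law P m k.
Proof. by move=> mk; exists (jointlaw m mk); exact: is_joint_jointlaw. Qed.

Lemma joint_law_unique P P' m k :
  is_joint_law P m k -> is_joint_law P' m k -> measure_eq P P'.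
Proof.
move=> PE P'E.
apply: (probability_eq_pi_system (@measurable_prod_measurableType _ _ X W)).
  move=> _ _ [A1 mA1 [B1 mB1 <-]] [A2 mA2 [B2 mB2 <-]].
  exists (A1 `&` A2); first exact: measurableI.
  by exists (B1 `&` B2); [exact: measurableI|rewrite setXI].
by move=> _ [A mA [B mB <-]]; rewrite PE// P'E.
Qed.

Lemma marginal_joint_law P m k : is_joint_law P m k ->
  measure_eq (marginal P) m.
Proof.
move=> PE A mA; rewrite -[LHS]/(P (fst @^-1` A)).
rewrite (_ : fst @^-1` A = A `*` setT); last by rewrite setXT.
rewrite PE// (eq_integral (cst 1)) ?integral_cst ?mul1e//.
by move=> x _; rewrite probability_setT.
Qed.

Section integral.
Variables (P : probability (X * W)%type R) (m : probability X R).
Variable k : X -> probability W R.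
Hypothesis mk : measurable_fun setT (k : X -> pprobability W R).
Hypothesis Pmk : is_joint_law P m k.

Lemma ge0_integral_joint_law (h : X * W -> \bar R) :
  measurable_fun setT h -> (forall z, 0 <= h z) ->
  \int[P]_z h z = \int[m]_x \int[k x]_y h (x, y).
Proof.
move=> mh h0; rewrite -(integral_bind m mk)//.
apply: integral_measure_eq => A mA.
transitivity (jointlaw m mk A); last exact: jointlawE.
exact: (joint_law_unique Pmk (is_joint_jointlaw m mk)).
Qed.

Variable h : X * W -> \bar R.
Hypothesis Ph : P.-integrable setT h.

Let mh : measurable_fun setT h. Proof. exact: measurable_int Ph. Qed.

Let mhp : measurable_fun setT h^\+. Proof. exact: measurable_funepos. Qed.
Let mhn : measurable_fun setT h^\-. Proof. exact: measurable_funeneg. Qed.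

Let Fp x := \int[k x]_y h^\+ (x, y).
Let Fn x := \int[k x]_y h^\- (x, y).

Let Fp_int : m.-integrable setT Fp.
Proof.
apply/integrableP; split; first exact: measurable_cond_integral.
rewrite (eq_integral Fp); last first.
  by move=> x _; rewrite gee0_abs//; apply: integral_ge0.
by rewrite -ge0_integral_joint_law// integral_funepos_lt_pinfty.
Qed.

Let Fn_int : m.-integrable setT Fn.
Proof.
apply/integrableP; split; first exact: measurable_cond_integral.
rewrite (eq_integral Fn); last first.
  by move=> x _; rewrite gee0_abs//; apply: integral_ge0.
by rewrite -ge0_integral_joint_law// integral_funeneg_lt_pinfty.
Qed.

Lemma cond_integrable : \forall x \ae m,
  (k x).-integrable setT (fun y => h (x, y)).
Proof.
have := integrable_ae measurableT Fp_int; have := integrable_ae measurableT Fn_int.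
apply: filterS2 => x /(_ I) fn /(_ I) fp; apply/integrableP; split.
  exact: measurableT_comp mh (pair1_measurable x).
rewrite (eq_integral (fun y => h^\+ (x, y) + h^\- (x, y))); last first.
  by move=> y _; exact: (congr1 (@^~ (x, y)) (fune_abse h)).
rewrite ge0_integralD//.
- by rewrite lte_add_pinfty// -ge0_fin_numE//; apply: integral_ge0.
- exact: measurableT_comp mhp (pair1_measurable x).
- exact: measurableT_comp mhn (pair1_measurable x).
Qed.

Let cond_integralE x : \int[k x]_y h (x, y) = Fp x - Fn x.
Proof.
rewrite integralE; congr (_ - _); apply: eq_integral => y _.
  by rewrite !funeposE.
by rewrite !funenegE.
Qed.

Lemma cond_integral_integrable :
  m.-integrable setT (fun x => \int[k x]_y h (x, y)).
Proof.
have -> : (fun x => \int[k x]_y h (x, y)) = Fp \- Fn.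
  by apply/funext => x; exact: cond_integralE.
exact: integrableB.
Qed.

Lemma integral_joint_law : \int[P]_z h z = \int[m]_x \int[k x]_y h (x, y).
Proof.
rewrite integralE !ge0_integral_joint_law//.
rewrite -(integralB measurableT Fp_int Fn_int); apply: eq_integral => x _.
exact/esym/cond_integralE.
Qed.

End integral.

End joint_law.

Section cond_law_unique.
Context {R : realType} {dX dW : measure_display}
  {X : measurableType dX} {W : polishType R dW}.

(** Finite intersections of balls of rational radius around the centers, indexed by codes of finite
    lists. Countability lets almost sure equalities, one per generator, be combined. *)
Lemma countable_pi_system : exists G : nat -> set W,
  [/\ measurable = <<s range G >>, setI_closed (range G)
    & forall n, measurable (G n)].
Proof.
have [M] := @dense_metric_exists R dW W.
pose B (p : nat * rat) : set W := [set y | (dist M (center M p.1) y < ratr p.2)%R].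
pose G (n : nat) : set W :=
  \bigcap_(p in [set` odflt [::] (unpickle n : option (seq (nat * rat)))]) B p.
have GE (s : seq (nat * rat)) : G (pickle s) = \bigcap_(p in [set` s]) B p.
  by rewrite /G pickleK.
have mB p : measurable (B p) by exact: measurable_dist.
have mG n : measurable (G n).
  rewrite /G; elim: (odflt _ _) => [|p s IH].
    rewrite [X in measurable X](_ : _ = setT)//.
    by apply/seteqP; split.
  rewrite [X in measurable X](_ : _ = B p `&` \bigcap_(q in [set` s]) B q).
    exact: measurableI.
  apply/seteqP; split => x /=.
    move=> h; split; first by apply: h; rewrite /= inE eqxx.
    by move=> q /= qs; apply: h; rewrite /= inE qs orbT.
  by move=> [Bp h] q /=; rewrite inE => /predU1P[->//|qs]; exact: h.
exists G; split => //.
- apply/seteqP; split; last first.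
    apply: smallest_sub; first exact: sigma_algebra_measurable.
    by move=> _ [n _ <-]; exact: mG.
  suff mid : measurable_fun setT (id : g_sigma_algebraType (range G) -> W).
    by move=> A mA; have := mid measurableT A mA; rewrite setTI.
  apply: (@measurable_fun_dist _ _ _ M) => n r.
  rewrite [X in measurable X](_ : _ = \bigcup_(q in [set q : rat | (ratr q < r)%R])
      (B (n, q) : set (g_sigma_algebraType (range G)))).
    rewrite bigcup_mkcond; apply: countable_bigcupT_measurable => // q.
    case: ifP => // _; apply: sub_sigma_algebra; exists (pickle [:: (n, q)]) => //.
    rewrite GE; apply/seteqP; split => [x h|x Bx p /=].
      by apply: h; rewrite /= inE.
    by rewrite inE => /eqP ->.
  apply/seteqP; split => x /=.
    by move=> /rat_in_itvoo[q]; rewrite in_itv/= => /andP[xq qr]; exists q.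
  by move=> [q /= qr /lt_trans]; apply.
- move=> _ _ [m _ <-] [n _ <-].
  pose s : seq (nat * rat) := odflt [::] (unpickle m).
  pose t : seq (nat * rat) := odflt [::] (unpickle n).
  exists (pickle (s ++ t)) => //; rewrite GE; apply/seteqP; split => x.
    by move=> h; split => p /= ps; apply: h; rewrite /= mem_cat ps ?orbT.
  by move=> [hs ht] p /=; rewrite mem_cat => /orP[/hs|/ht].
Qed.

(** For each generator, both kernels have the same integrals over all measurable sets of [x], hence
    agree off a null set; the union of these null sets is null. *)
Lemma cond_law_unique (P : probability (X * W)%type R) (m1 m2 : probability X R)
    (k1 k2 : X -> probability W R) :
  measurable_fun setT (k1 : X -> pprobability W R) ->
  measurable_fun setT (k2 : X -> pprobability W R) ->
  measure_eq m1 m2 ->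
  is_joint_law P m1 k1 -> is_joint_law P m2 k2 ->
  \forall x \ae m1, measure_eq (k1 x) (k2 x).
Proof.
move=> mk1 mk2 m12 P1 P2.
have [G [mGE GI mG]] := countable_pi_system.
have : \forall x \ae m1, forall n, k1 x (G n) = k2 x (G n).
  apply: ae_foralln => n.
  suff : ae_eq m1 setT (fun x => k1 x (G n)) (fun x => k2 x (G n)).
    by apply: filterS => x; exact.
  apply: integral_ae_eq => //.
  - apply: (@le_integrable _ _ _ _ _ measurableT _ (cst 1)).
    + exact: measurable_pprobability_eval.
    + by move=> x _; rewrite gee0_abs// abse1 probability_le1.
    + exact: finite_measure_integrable_cst.
  - exact: measurable_pprobability_eval.
  - move=> E _ mE; rewrite -P1// P2//; apply: eq_measure_integral => A mA _.
    by rewrite m12.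
apply: filterS => x k12; apply: (probability_eq_pi_system mGE GI).
by move=> _ [n _ <-].
Qed.

End cond_law_unique.

(** * The conditional moment identity *)

Section nprod.
Context {n : nat} {dN : 'I_n -> measure_display}
  {N0 : forall j : 'I_n, measurableType (dN j)}.
Local Notation N := (nprod N0).

Lemma measurable_nprod_coord (j : 'I_n) :
  measurable_fun setT (fun v : N => v j).
Proof.
move=> _ B mB; rewrite setTI; apply: sub_sigma_algebra.
by exists j => //; exists B => //; rewrite setTI.
Qed.

Lemma measurable_fun_nprod d (T : measurableType d) (g : T -> N) :
  (forall j, measurable_fun setT (fun x => g x j)) -> measurable_fun setT g.
Proof.
move=> mg; refine (@measurability _ _ T (nprod N0) setT g (@cylinders _ _ N0) erefl _).
move=> _ [_ [j _ [B mB <-]] <-]; rewrite !setTI.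
by have := mg j measurableT B mB; rewrite setTI.
Qed.

End nprod.

Lemma ae_eq_integrable d (T : measurableType d) (R : realType)
    (m : measure T R) (f g : T -> \bar R) :
  measurable_fun setT g -> ae_eq m setT f g ->
  m.-integrable setT f -> m.-integrable setT g.
Proof.
move=> mg fg /integrableP[mf foo]; apply/integrableP; split => //.
rewrite (ae_eq_integral (abse \o f))//.
- exact: measurableT_comp.
- exact: measurableT_comp.
- by apply: ae_eq_abse; symmetry.
Qed.

Lemma conditioned_eq0 d (T : measurableType d) (R : realType)
    (m : probability T R) (A B : set T) (mA : measurable A) :
  0 < m A -> measurable B -> m (B `&` A) = 0 ->
  mnormalize (mrestr m mA) m B = 0.
Proof.
move=> A0 mB BA; rewrite /mnormalize.
have mT : mrestr m mA setT = m A by rewrite /mrestr setTI.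
case: ifPn => [/orP[]|_].
- by rewrite [X in X == 0]mT gt_eqF.
- by rewrite [X in X == _]mT lt_eqF// -ge0_fin_numE// fin_num_measure.
- by rewrite [X in X * _](_ : _ = 0) ?mul0e.
Qed.

(** The difference is nonnegative almost everywhere with zero integral, hence vanishes almost
    everywhere, while a conull set of a probability is not empty. *)
Lemma integral_lt_absurd d (T : measurableType d) (R : realType)
    (m : probability T R) (A : set T) (g1 g2 : T -> \bar R) :
  measurable A -> m (~` A) = 0 ->
  m.-integrable setT g1 -> m.-integrable setT g2 ->
  \int[m]_x g1 x = \int[m]_x g2 x -> (forall x, A x -> g1 x < g2 x) -> False.
Proof.
move=> mA A0 i1 i2 i12 lt12.
have iD : m.-integrable setT (g2 \- g1) by exact: integrableB.
have mD := measurable_int _ iD.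
have Aae : \forall x \ae m, A x by exists (~` A); split => //; exact: measurableC.
have D0 : \int[m]_x `|(g2 \- g1) x| = 0.
  rewrite (ae_eq_integral (g2 \- g1))//.
  - rewrite integralB// i12 subee//; exact: integrable_fin_num.
  - exact: measurableT_comp.
  - apply: filterS Aae => x Ax _ /=; rewrite gee0_abs//.
    by rewrite ltW// sube_gt0 lt12.
have := (ae_eq_integral_abs m measurableT mD).1 D0.
move=> /(filterI Aae) /= FAD.
have pF : ProperFilter (almost_everywhere m).
  by apply: ae_properfilter_algebraOfSetsType; rewrite [X in _ < X](probability_setT m).
have [x [Ax /(_ I) Dx]] := @filter_ex _ _ pF _ FAD.
by have := lt12 x Ax; rewrite -sube_gt0 [X in _ < X]Dx ltxx.
Qed.

Section conditional_mean.
Context {R : realType} {d : nat} {dX dW dU dK dA : measure_display}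
  {dN : 'I_d -> measure_display}
  {X : polishType R dX} {W : polishType R dW} {U : polishType R dU}
  {N0 : forall j : 'I_d, polishType R (dN j)}
  {K0 : polishType R dK} {Waux : polishType R dA}.

Local Notation XW := (X * W)%type.
Local Notation N := (nprod (fun j => N0 j)).
Local Notation ambient := (X * W * N * K0 * Waux)%type.

Variable S : framework X W U N0 K0.
Implicit Types (P : probability XW R) (f : ambient -> R) (w : X -> Waux).

Lemma measurable_plug f (n : X -> N) (k : X -> K0) w :
  measurable_fun setT f -> measurable_fun setT n -> measurable_fun setT k ->
  measurable_fun setT w -> measurable_fun setT (plug f n k w).
Proof.
move=> mf mn mk mw; apply: (measurableT_comp mf).
have fstT (V : measurableType _) (g : X -> V) :
    measurable_fun setT g -> measurable_fun setT (fun z : XW => g z.1).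
  by move=> mg; exact: measurableT_comp mg measurable_fst.
do 3 (apply: measurable_fun_pair; last by exact: fstT).
apply: measurable_fun_pair; first exact: measurable_fst.
exact: measurable_snd.
Qed.

Lemma measurable_eta P : laws S P -> measurable_fun setT (eta S P : X -> N).
Proof. by move=> lP; apply: measurable_fun_nprod => j; exact: eta_meas. Qed.

Lemma measurable_target P : laws S P ->
  measurable_fun setT (fun x => psi S (x, u S P x)).
Proof.
move=> lP; apply: (measurableT_comp (psi_meas S)).
by apply: measurable_fun_pair => //; exact: u_meas.
Qed.

Definition neighbor P P' := exists j : 'I_d, forall l : 'I_d, l != j ->
  \forall x \ae marginal P, eta S P' x l = eta S P x l.

Section nonpositive.
Variables (P P' : probability XW R) (f : ambient -> R) (w : X -> Waux).
Hypotheses (closed : reweighting_closure S) (lP : laws S P) (lP' : laws S P')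
  (mw : measurable_fun setT w) (PP' : neighbor P P') (fB : FB S f).

Let h := plug f (eta S P') (kappa S P) w.
Let m := marginal P.
Let cm x := \int[Q S P x]_y (h (x, y))%:E.
Let t x := psi S (x, u S P x).

Let mh : measurable_fun setT h.
Proof.
apply: measurable_plug => //; [exact: fB.1|exact: measurable_eta|].
exact: kappa_meas.
Qed.

Let mQ : measurable_fun setT (Q S P : X -> pprobability W R).
Proof. exact: (Q_cond lP).1. Qed.

Let Ph : P.-integrable setT (EFin \o h).
Proof. exact: (fB.2 P P' w lP lP' mw PP').1. Qed.

Let cm_int : m.-integrable setT cm.
Proof. refine (cond_integral_integrable mQ (Q_cond lP).2 Ph). Qed.

Let mcm : measurable_fun setT cm. Proof. exact: measurable_int cm_int. Qed.
Let mt : measurable_fun setT t. Proof. exact: measurable_target. Qed.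

(** Testing the moment identity on the law of [P] conditioned on [A]. *)
Lemma reweighted_mean (A : set X) (mA : measurable A) : 0 < m A ->
  let mA' := mnormalize (mrestr m mA) m in
  [/\ mA'.-integrable setT cm, mA'.-integrable setT (EFin \o t)
    & \int[mA']_x cm x = \int[mA']_x (t x)%:E].
Proof.
move=> A0 mA'.
have [P1 P1E] := joint_law_exists mA' mQ.
have [lP1 eqA] := closed lP A0 P1E.
have domA B : measurable B -> m B = 0 -> mA' B = 0.
  move=> mB B0; apply: conditioned_eq0 => //; apply/eqP.
  rewrite eq_le measure_ge0 andbT -B0 le_measure ?inE//.
  exact: measurableI.
have marg1 := marginal_joint_law P1E.
have dom B : measurable B -> m B = 0 -> marginal P1 B = 0.
  by move=> mB B0; rewrite marg1//; exact: domA.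
have mA'C : mA' (~` A) = 0.
  by apply: conditioned_eq0; rewrite ?setICl ?measure0//; exact: measurableC.
have inA : \forall x \ae marginal P1, A x.
  exists (~` A); split => //; first exact: measurableC.
  by rewrite marg1//; exact: measurableC.
have eqA1 : \forall x \ae marginal P1,
    eta S P1 x = eta S P x /\ kappa S P1 x = kappa S P x.
  have := ae_dominated dom eqA.
  by apply: filterS2 inA => x Ax; apply.
have [j jP] := PP'.
(* [P'] remains a legitimate partner, as conditioning on [A] leaves eta unchanged there. *)
have nb : neighbor P1 P'.
  exists j => l lj; have := ae_dominated dom (jP l lj).
  by apply: filterS2 eqA1 => x [-> _].
have [int1 E1] := fB.2 P1 P' w lP1 lP' mw nb.
have mh1 : measurable_fun setT (plug f (eta S P') (kappa S P1) w).
  by apply: measurable_plug => //; [exact: fB.1|exact: measurable_eta|exact: kappa_meas].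
have [N [mN N0' NP]] := eqA1.
have hh1 : ae_eq P1 setT (EFin \o plug f (eta S P') (kappa S P1) w) (EFin \o h).
  exists (fst @^-1` N); split.
  - by rewrite -[X in measurable X]setTI; exact: measurable_fst.
  - exact: N0'.
  - move=> z /=; apply: contra_notP => nN; rewrite /h /plug.
    have [_ ->//] : eta S P1 z.1 = eta S P z.1 /\ kappa S P1 z.1 = kappa S P z.1.
    by apply: contrapT => ne; apply: nN; exact: NP.
have h1 : P1.-integrable setT (EFin \o h).
  by apply: ae_eq_integrable int1 => //; exact/measurable_EFinP.
(* Closure speaks of eta and kappa only. That [u] is unchanged follows from its local rule, the two
   conditional laws being equal by uniqueness. *)
have u1 : \forall x \ae marginal P1, u S P1 x = u S P x.
  have mQ1 := (Q_cond lP1).1; have JQ1 := (Q_cond lP1).2.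
  have := cond_law_unique mQ1 mQ marg1 JQ1 P1E.
  apply: filterS3 (u_locE lP1) (ae_dominated dom (u_locE lP)) => x -> -> QQ.
  exact: u_loc_eq.
have tE : ae_eq (marginal P1) setT (fun x => (psi S (x, u S P1 x))%:E) (EFin \o t).
  by apply: filterS u1 => x /= -> _.
have mt1 := measurable_target lP1.
split.
- refine (cond_integral_integrable mQ P1E h1).
- apply: (integrable_measure_eq (m2 := marginal P1)).
    by move=> B mB; rewrite marg1.
  by apply: ae_eq_integrable (psi_int lP1) => //; exact/measurable_EFinP.
- transitivity (\int[P1]_z (EFin \o h) z).
    exact: esym (integral_joint_law mQ P1E h1).
  transitivity (\int[P1]_z (EFin \o plug f (eta S P') (kappa S P1) w) z).
    by apply: ae_eq_integral => //; [exact/measurable_EFinP..|symmetry].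
  transitivity (\int[marginal P1]_x (psi S (x, u S P1 x))%:E).
    by move: E1; rewrite /target unlock.
  transitivity (\int[marginal P1]_x (EFin \o t) x).
    by apply: ae_eq_integral => //; exact/measurable_EFinP.
  exact: integral_measure_eq marg1.
Qed.

(** Two tests suffice: the sets where the conditional mean is strictly below, or strictly above, the
    target integrand. Conditioned on such a set of positive mass, the strict inequality contradicts
    the equality of integrals. *)
Lemma cond_mean_neighbor : \forall x \ae m,
  (Q S P x).-integrable setT (fun y => (h (x, y))%:E) /\ cm x = (t x)%:E.
Proof.
have mtE : measurable_fun setT (EFin \o t) by exact/measurable_EFinP.
have lt_null (g1 g2 : X -> \bar R) :
    measurable_fun setT g1 -> measurable_fun setT g2 ->
    (forall (A : set X) (mA : measurable A), 0 < m A ->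
      let mA' := mnormalize (mrestr m mA) m in
      [/\ mA'.-integrable setT g1, mA'.-integrable setT g2
        & \int[mA']_x g1 x = \int[mA']_x g2 x]) ->
    \forall x \ae m, ~ (g1 x < g2 x).
  move=> mg1 mg2 g12.
  pose A := [set x | g1 x < g2 x].
  have mA : measurable A.
    rewrite -[A]setTI; exact: measurable_lte.
  suff A0 : m A = 0 by exists A; split => // x /= /contrapT.
  apply/eqP; apply: contraT => /eqP A0.
  have mA0 : 0 < m A by rewrite lt_neqAle measure_ge0 andbT eq_sym; exact/eqP.
  have [i1 i2 i12] := g12 A mA mA0.
  exfalso; apply: (@integral_lt_absurd _ _ _ _ A g1 g2 mA _ i1 i2 i12) => //.
  by apply: conditioned_eq0; rewrite ?setICl ?measure0//; exact: measurableC.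
have /= le1 : \forall x \ae m, ~ (cm x < (t x)%:E).
  by apply: lt_null => // A mA A0; exact: reweighted_mean.
have /= le2 : \forall x \ae m, ~ ((t x)%:E < cm x).
  by apply: lt_null => // A mA A0; have [] := reweighted_mean mA A0.
have ci : \forall x \ae m, (Q S P x).-integrable setT (fun y => (h (x, y))%:E).
  refine (cond_integrable mQ (Q_cond lP).2 Ph).
apply: filterS3 le1 le2 ci => x /negP + /negP + ix; split => //.
by apply/eqP; rewrite eq_le !leNgt; apply/andP.
Qed.

End nonpositive.

End conditional_mean.

(** * The variance floor *)

Section essential_infimum.
Context {R : realType} {d : measure_display} {X : measurableType d}.
Variables (m : probability X R) (H : set (X -> \bar R)).

Lemma ess_inf_familyP : (exists g, is_ess_inf m H g) ->
  is_ess_inf m H (ess_inf_family m H).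
Proof.
by move=> [g gP]; rewrite /ess_inf_family; case: xgetP => [_ -> //|/(_ g)].
Qed.

Lemma is_ess_inf_ae g1 g2 : is_ess_inf m H g1 -> is_ess_inf m H g2 ->
  ae_eq m setT g1 g2.
Proof.
move=> [mg1 g1H H1] [mg2 g2H H2].
apply: filterS2 (H1 _ mg2 g2H) (H2 _ mg1 g1H) => x g21 g12 _.
by apply/eqP; rewrite eq_le g12.
Qed.

Lemma integral_ess_inf_empty : H = set0 ->
  \int[m]_x ess_inf_family m H x = +oo.
Proof.
move=> H0.
have infty : is_ess_inf m H (cst +oo).
  split; [exact: measurable_cst|by rewrite H0|].
  by move=> g' _ _; apply: aeW => x; rewrite leey.
have HP := ess_inf_familyP (ex_intro _ _ infty).
have [mE _ _] := HP.
rewrite (ae_eq_integral (cst +oo))//; last exact: is_ess_inf_ae HP infty.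
by rewrite integral_cst// [X in _ * X](probability_setT m) mule1.
Qed.

Hypothesis Hm : forall h, H h -> measurable_fun setT h.
Hypothesis H0 : forall h x, H h -> 0 <= h x.
Hypothesis Hfin : forall h, H h -> \int[m]_x h x < +oo.
Hypothesis Hmin : forall h1 h2, H h1 -> H h2 ->
  H (fun x => mine (h1 x) (h2 x)).

Let H_int h : H h -> m.-integrable setT h.
Proof.
move=> Hh; apply/integrableP; split; first exact: Hm.
rewrite (eq_integral h); first exact: Hfin.
by move=> x _; rewrite gee0_abs// H0.
Qed.

Let c := ereal_inf [set \int[m]_x h x | h in H].

Let c_le h : H h -> c <= \int[m]_x h x.
Proof. by move=> Hh; apply: ereal_inf_lbound; exists h. Qed.

(** Dominated convergence, with [k 0] as dominating function. The limit need not belong to [H], so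
    [c_le] does not apply to it directly. *)
Let nonincreasing_limit_ge (k : (X -> \bar R)^nat) (g : X -> \bar R) :
  (forall n, H (k n)) -> measurable_fun setT g ->
  (forall x, k n x @[n --> \oo] --> g x) ->
  (forall n x, k n.+1 x <= k n x) -> c <= \int[m]_x g x.
Proof.
move=> Hk mg kg nik.
have [|||||_ _ cvk] := @dominated_convergence _ _ _ m _ measurableT k g (k 0%N).
- by move=> n; exact: Hm.
- exact: mg.
- by apply: aeW => x _.
- exact: H_int.
- apply: aeW => x n _; rewrite gee0_abs ?H0//.
  by elim: n => // n; exact: le_trans.
rewrite -(cvg_lim _ cvk)//; apply: lime_ge; first exact: cvgP cvk.
by apply: nearW => n; exact: c_le.
Qed.

Lemma integral_ess_inf_family : H !=set0 ->
  \int[m]_x ess_inf_family m H x = ereal_inf [set \int[m]_x h x | h in H].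
Proof.
move=> [h0 Hh0]; rewrite -/c.
have c0 : 0 <= c.
  by apply: le_ereal_inf_tmp => _ [h Hh <-]; apply: integral_ge0 => x _; exact: H0.
have cfin : c \is a fin_num by rewrite ge0_fin_numE// (le_lt_trans (c_le Hh0))// Hfin.
have /choice[h] n : exists h, H h /\ \int[m]_x h x < c + n.+1%:R^-1%:E.
  have n0 : (0 < n.+1%:R^-1 :> R)%R by rewrite invr_gt0.
  by have [_ [h Hh <-] hc] := lb_ereal_inf_adherent n0 cfin; exists h.
move=> /all_and2[Hh hc].
pose k := fix k n := if n is n'.+1
  then fun x => mine (k n' x) (h n x) else h 0%N.
have Hk n : H (k n) by elim: n => [|n IH]; [exact: Hh|exact: Hmin].
have nik n x : k n.+1 x <= k n x by rewrite /= ge_min lexx.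
have kh n x : k n x <= h n x by case: n => //= n; rewrite ge_min lexx orbT.
have ndk x : nonincreasing_seq (k ^~ x) by apply/nonincreasing_seqP => n; exact: nik.
pose g x := ereal_inf (range (k ^~ x)).
have kg x : k n x @[n --> \oo] --> g x by exact: ereal_nonincreasing_cvgn.
have gk n x : g x <= k n x by apply: ereal_inf_lbound; exists n.
have mg : measurable_fun setT g.
  by apply: (emeasurable_fun_cvg k) => [n|x _]; [exact: Hm|exact: kg].
have g0 x : 0 <= g x by apply: le_ereal_inf_tmp => _ [n _ <-]; exact: H0.
have gc : \int[m]_x g x <= c.
  apply/lee_addgt0Pr => e e0; have [n] := ltr_add_invr e0; rewrite add0r => ne.
  apply: (@le_trans _ _ (\int[m]_x h n x)).
    apply: ge0_le_integral => //; first exact: Hm.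
    by move=> x _; exact: le_trans (gk n x) (kh n x).
  by apply: le_trans (ltW (hc n)) _; rewrite leeD2l// lee_fin ltW.
have gE : \int[m]_x g x = c.
  by apply/eqP; rewrite eq_le gc/=; exact: (nonincreasing_limit_ge Hk mg kg nik).
have g_int : m.-integrable setT g.
  apply/integrableP; split => //; rewrite (eq_integral g).
    by rewrite gE -ge0_fin_numE.
  by move=> x _; rewrite gee0_abs.
have gP : is_ess_inf m H g.
  split => // [h1 Hh1|g' mg' g'H].
    (* Why [g] lies below [h1]: [g1] is again a limit of a nonincreasing sequence of members of [H],
       so its integral is at least [c], that of [g]; as [g1 <= g], they agree almost everywhere. *)
    pose g1 x := mine (g x) (h1 x).
    have mg1 : measurable_fun setT g1 by apply: measurable_mine => //; exact: Hm.
    have g10 x : 0 <= g1 x by rewrite le_min g0 H0.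
    have g1g x : g1 x <= g x by rewrite ge_min lexx.
    have g1_int : m.-integrable setT g1.
      by apply: le_integrable g_int => // x _; rewrite !gee0_abs.
    have cg1 : c <= \int[m]_x g1 x.
      apply: (nonincreasing_limit_ge (k := fun n x => mine (k n x) (h1 x))) => //.
      - by move=> n; exact: Hmin.
      - move=> x; rewrite (_ : g1 x = ereal_inf (range (fun n => mine (k n x) (h1 x)))).
          apply: ereal_nonincreasing_cvgn; apply/nonincreasing_seqP => n.
          by rewrite le_min2.
        apply/eqP; rewrite eq_le; apply/andP; split.
          by apply: le_ereal_inf_tmp => _ [n _ <-]; rewrite le_min2.
        have infle n : ereal_inf (range (fun n => mine (k n x) (h1 x)))
            <= mine (k n x) (h1 x) by apply: ereal_inf_lbound; exists n.
        rewrite le_min; apply/andP; split.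
          apply: le_ereal_inf_tmp => _ [n _ <-]; apply: le_trans (infle n) _.
          by rewrite ge_min lexx.
        by apply: le_trans (infle 0%N) _; rewrite ge_min lexx orbT.
      - by move=> n x; rewrite le_min2.
    have gg1 : \int[m]_x `|(g \- g1) x| = 0.
      rewrite (ae_eq_integral (g \- g1))//; last first.
      - apply: filterS (integrable_ae measurableT g_int) => x /(_ I) gx _ /=.
        by rewrite gee0_abs// sube_ge0 ?g1g// gx orbT.
      - exact: emeasurable_funB.
      - by apply: measurableT_comp => //; exact: emeasurable_funB.
      rewrite integralB// (_ : \int[m]_x g1 x = c) ?gE ?subee//.
      by apply/eqP; rewrite eq_le cg1 andbT -gE; apply: ge0_le_integral.
    have mgg1 : measurable_fun setT (g \- g1) by exact: emeasurable_funB.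
    have := (ae_eq_integral_abs m measurableT mgg1).1 gg1.
    apply: filterS2 (integrable_ae measurableT g_int) => x /(_ I) gx /(_ I) /= gg1x.
    apply: (@le_trans _ _ (g1 x)); last by rewrite ge_min lexx orbT.
    by rewrite -sube_le0 gg1x.
  have : \forall x \ae m, forall n, g' x <= k n x.
    by apply: ae_foralln => n; exact: g'H.
  by apply: filterS => x g'k; apply: le_ereal_inf_tmp => _ [n _ <-].
have HP := ess_inf_familyP (ex_intro _ _ gP).
have [mE _ _] := HP.
by rewrite -gE; apply: ae_eq_integral => //; exact: is_ess_inf_ae.
Qed.

End essential_infimum.

Lemma integral_square_shift d (T : measurableType d) (R : realType)
    (m : probability T R) (g : T -> R) (a c : R) :
  m.-integrable setT (EFin \o g) -> \int[m]_x (g x)%:E = a%:E ->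
  \int[m]_x ((g x - c) ^+ 2)%:E =
  \int[m]_x ((g x - a) ^+ 2)%:E + ((a - c) ^+ 2)%:E.
Proof.
move=> gi ga.
have mg : measurable_fun setT g by apply/measurable_EFinP; exact: measurable_int gi.
pose v x := (2 * (a - c) * (g x - a))%R.
have vi : m.-integrable setT (EFin \o v).
  apply: (eq_integrable measurableT (fun x => (2 * (a - c))%:E * ((g x)%:E - a%:E))) => //.
  apply: integrableZl => //; apply: integrableB => //.
  exact: finite_measure_integrable_cst.
have v0 : \int[m]_x (v x)%:E = 0.
  rewrite (eq_integral (fun x => (2 * (a - c))%:E * ((g x)%:E - a%:E)))//.
  rewrite integralZl//; last by apply: integrableB => //; exact: finite_measure_integrable_cst.
  rewrite integralB//; last exact: finite_measure_integrable_cst.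
  rewrite ga integral_cst// [X in _ * (_ - _ * X)](probability_setT m).
  by rewrite mule1 subee// mule0.
have avi : m.-integrable setT (EFin \o (fun x => `|v x|%R)) by exact: integrable_norm.
have Ifin : \int[m]_x (`|v x|%R)%:E \is a fin_num by exact: integrable_fin_num.
have mv : measurable_fun setT v.
  by apply/measurable_EFinP; exact: measurable_int vi.
have msq b : measurable_fun setT (fun x => ((g x - b) ^+ 2)%:E).
  by apply/measurable_EFinP/measurable_funX/measurable_funB.
have mav : measurable_fun setT (fun x => (`|v x|%R)%:E).
  exact: measurable_int avi.
(* adding the finite integral of [`|v|] makes every term nonnegative, so the
   squares need not be integrable *)
rewrite -(addeK (\int[m]_x ((g x - c) ^+ 2)%:E) Ifin).
rewrite -ge0_integralD//; [|by move=> x _; rewrite lee_fin sqr_ge0..].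
rewrite (eq_integral (fun x => ((g x - a) ^+ 2)%:E +
    ((v x + `|v x|)%:E + ((a - c) ^+ 2)%:E))); last first.
  by move=> x _; rewrite -!EFinD; congr EFin; rewrite /v; ring.
have v2 x : (0 <= v x + `|v x|)%R by have := ler_norm (- v x)%R; rewrite normrN; lra.
have mv2 : measurable_fun setT (fun x => (v x + `|v x|)%:E).
  by apply/measurable_EFinP/measurable_funD => //; exact/measurable_EFinP.
rewrite ge0_integralD//; last 3 first.
- by move=> x _; rewrite lee_fin sqr_ge0.
- by move=> x _; rewrite adde_ge0// lee_fin ?sqr_ge0.
- by apply: emeasurable_funD.
rewrite ge0_integralD//; last 2 first.
- by move=> x _; rewrite lee_fin v2.
- by move=> x _; rewrite lee_fin sqr_ge0.
rewrite integral_cst// [X in _ * X](probability_setT m) mule1.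
rewrite [X in _ + (X + _)](_ : _ = \int[m]_x (`|v x|%R)%:E); last first.
  under eq_integral do rewrite EFinD.
  by rewrite integralD// v0 add0e.
by rewrite addeCA [X in X - _]addeC addeK.
Qed.

Lemma variance_integral d (T : measurableType d) (R : realType)
    (m : probability T R) (g : T -> R) :
  'V_m[g] = \int[m]_x ((g x - fine 'E_m[g]) ^+ 2)%:E.
Proof.
rewrite /variance covariance.unlock expectation.unlock.
by apply: eq_integral => x _; rewrite expr2.
Qed.

Section variance_floor.
Context {R : realType} {d : nat} {dX dW dU dK dA : measure_display}
  {dN : 'I_d -> measure_display}
  {X : polishType R dX} {W : polishType R dW} {U : polishType R dU}
  {N0 : forall j : 'I_d, polishType R (dN j)}
  {K0 : polishType R dK} {Waux : polishType R dA}.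
Hypothesis d_gt0 : (0 < d)%N.

Local Notation XW := (X * W)%type.
Local Notation N := (nprod (fun j => N0 j)).
Local Notation ambient := (X * W * N * K0 * Waux)%type.

Variable S : framework X W U N0 K0.
Hypothesis closed : reweighting_closure S.
Implicit Types (f : ambient -> R) (w : X -> Waux).

Lemma neighbor_refl (P : probability XW R) : neighbor S P P.
Proof. by exists (Ordinal d_gt0) => l _; exact: aeW. Qed.

Lemma measurable_score f P w : laws S P -> FB S f -> measurable_fun setT w ->
  measurable_fun setT (score S f P w).
Proof.
move=> lP fB mw; apply: measurable_plug => //; first exact: fB.1.
  exact: measurable_eta.
exact: kappa_meas.
Qed.

Lemma cond_meanE f P w : laws S P -> FB S f -> measurable_fun setT w ->
  \forall x \ae marginal P,
    (Q S P x).-integrable setT (fun y => (score S f P w (x, y))%:E) /\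
    cond_mean S f P w x = (psi S (x, u S P x))%:E.
Proof.
move=> lP fB mw.
have := cond_mean_neighbor closed lP lP mw (neighbor_refl P) fB.
by apply: filterS => x [? ?]; rewrite /cond_mean expectation.unlock.
Qed.

Lemma cond_var_ge0 f P w x : 0 <= cond_var S f P w x.
Proof.
by rewrite /cond_var variance_integral; apply: integral_ge0 => y _; rewrite lee_fin sqr_ge0.
Qed.

Lemma measurable_cond_var f P w : laws S P -> FB S f -> measurable_fun setT w ->
  measurable_fun setT (cond_var S f P w).
Proof.
move=> lP fB mw; have ms := measurable_score lP fB mw.
have [mQ JQ] := Q_cond lP.
have Ps := (fB.2 P P w lP lP mw (neighbor_refl P)).1.
have mcm : measurable_fun setT (cond_mean S f P w).
  apply: (eq_measurable_fun (fun x => \int[Q S P x]_y (score S f P w (x, y))%:E)).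
    by move=> x _; rewrite /cond_mean expectation.unlock.
  refine (measurable_int _ (cond_integral_integrable mQ JQ Ps)).
apply: (eq_measurable_fun (fun x => \int[Q S P x]_y
    ((score S f P w (x, y) - fine (cond_mean S f P w x)) ^+ 2)%:E)).
  by move=> x _; rewrite /cond_var variance_integral.
apply: (measurable_cond_integral (h := fun z : XW =>
    ((score S f P w z - fine (cond_mean S f P w z.1)) ^+ 2)%:E) mQ) => //.
  apply/measurable_EFinP/measurable_funX/measurable_funB => //.
  apply: (measurableT_comp (f := fine)) => //.
  exact: measurableT_comp mcm measurable_fst.
by move=> z; rewrite lee_fin sqr_ge0.
Qed.

(** About the overall mean [c], the second moment of the conditional law at [x] is its variance plus
    [(psi - c) ^+ 2], by [integral_square_shift] at the conditional mean. Only nonnegative functions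
    are integrated, so both sides may be infinite. *)
Lemma total_variance f P w : laws S P -> FB S f -> measurable_fun setT w ->
  'V_P[score S f P w] = 'V_(marginal P)[fun x => psi S (x, u S P x)]
    + \int[marginal P]_x cond_var S f P w x.
Proof.
move=> lP fB mw; have ms := measurable_score lP fB mw.
have [mQ JQ] := Q_cond lP.
have [Ps EP] := fB.2 P P w lP lP mw (neighbor_refl P).
have EPt : 'E_P[score S f P w] = target S P by exact: EP.
rewrite !variance_integral EPt -/(target S P); set c := fine (target S P).
rewrite (ge0_integral_joint_law mQ JQ (h := fun z => ((score S f P w z - c) ^+ 2)%:E));
  last 2 first.
- by apply/measurable_EFinP/measurable_funX/measurable_funB.
- by move=> z; rewrite lee_fin sqr_ge0.
have mt := measurable_target lP.
have mt2 : measurable_fun setT (fun x => ((psi S (x, u S P x) - c) ^+ 2)%:E).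
  by apply/measurable_EFinP/measurable_funX/measurable_funB.
have mcv := measurable_cond_var lP fB mw.
rewrite addeC -ge0_integralD//; last 2 first.
- by move=> x _; exact: cond_var_ge0.
- by move=> x _; rewrite lee_fin sqr_ge0.
apply: ae_eq_integral => //.
- apply: (measurable_cond_integral (h := fun z => ((score S f P w z - c) ^+ 2)%:E) mQ).
    by apply/measurable_EFinP/measurable_funX/measurable_funB.
  by move=> z; rewrite lee_fin sqr_ge0.
- exact: emeasurable_funD.
apply: filterS (cond_meanE lP fB mw) => x [ix cmx] _.
rewrite /cond_var variance_integral -/(cond_mean S f P w x) cmx /=.
apply: integral_square_shift => //.
by move: cmx; rewrite /cond_mean expectation.unlock.
Qed.

(** Membership in F_B quantifies over all auxiliary maps, so a score may absorb one of them. This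
    makes the variance floor independent of [w]. *)
Lemma FB_transfer f w : measurable_fun setT w -> FB S f ->
  FB S (fun z : ambient => f (z.1, w z.1.1.1.1)).
Proof.
move=> mw [mf fB]; split=> [|P P' w' lP lP' _ PP']; last exact: (fB P P' w).
apply: (measurableT_comp mf); apply: measurable_fun_pair; first exact: measurable_fst.
apply: (measurableT_comp mw).
do 3 apply: (measurableT_comp measurable_fst).
exact: measurable_fst.
Qed.

(** The moment identity alone says nothing about the contribution of [B]; its conditional form,
    available for every neighboring pair of laws, does. *)
Lemma FB_paste f1 f2 (B : set X) : measurable B -> FB S f1 -> FB S f2 ->
  FB S (fun z : ambient => if z.1.1.1.1 \in B then f1 z else f2 z).
Proof.
move=> mB fB1 fB2; set f3 : ambient -> R := fun z => _.
have m3 : measurable_fun setT f3.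
  apply: measurable_fun_ifT; [|exact: fB1.1|exact: fB2.1].
  apply: (measurable_fun_bool true); rewrite setTI.
  rewrite [X in measurable X](_ : _ = (fun z : ambient => z.1.1.1.1) @^-1` B).
    rewrite -[X in measurable X]setTI.
    suff : measurable_fun setT (fun z : ambient => z.1.1.1.1) by apply.
    do 3 apply: (measurableT_comp measurable_fst).
    exact: measurable_fst.
  by apply/seteqP; split => z; [exact: set_mem|exact: mem_set].
split=> // P P' w lP lP' mw PP'.
have [mQ JQ] := Q_cond lP.
have [i1 _] := fB1.2 P P' w lP lP' mw PP'.
have [i2 _] := fB2.2 P P' w lP lP' mw PP'.
pose h f := plug f (eta S P') (kappa S P) w.
have mh3 : measurable_fun setT (h f3).
  by apply: measurable_plug => //; [exact: measurable_eta|exact: kappa_meas].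
have i3 : P.-integrable setT (EFin \o h f3).
  apply: (le_integrable measurableT _ _
    (integrableD measurableT (integrable_abse i1) (integrable_abse i2))).
    exact/measurable_EFinP.
  move=> z _ /=; rewrite lee_fin [leRHS]ger0_norm ?addr_ge0//.
  by rewrite /h /plug /f3 /=; case: ifP => _; rewrite ?lerDl ?lerDr.
split => //.
rewrite /target expectation.unlock (integral_joint_law mQ JQ i3).
have mt := measurable_target lP.
apply: ae_eq_integral => //.
- refine (measurable_int _ (cond_integral_integrable mQ JQ i3)).
- exact/measurable_EFinP.
apply: filterS2 (cond_mean_neighbor closed lP lP' mw PP' fB1)
  (cond_mean_neighbor closed lP lP' mw PP' fB2) => x [_ e1] [_ e2] _.
have [xB|xB] := boolP (x \in B).
  by rewrite -e1; apply: eq_integral => y _; rewrite /h /plug /f3 /= xB.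
by rewrite -e2; apply: eq_integral => y _; rewrite /h /plug /f3 /= (negbTE xB).
Qed.

Section floor.
Variables (P : probability XW R) (lP : laws S P).

Let m := marginal P.
Let target_var := 'V_m[fun x => psi S (x, u S P x)].

Let finite_vars w : set (X -> \bar R) :=
  [set cond_var S f P w | f in [set f | FB S f /\ 'V_P[score S f P w] < +oo]].

Lemma Vmin_transfer w w0 : measurable_fun setT w -> measurable_fun setT w0 ->
  Vmin S P w = Vmin S P w0.
Proof.
move=> mw mw0; rewrite /Vmin; congr (ess_inf_family _ _).
suff sub w1 w2 : measurable_fun setT w1 -> finite_vars w1 `<=` finite_vars w2.
  by apply/seteqP; split; exact: sub.
move=> mw1 _ [f [fB Vf] <-].
exists (fun z : ambient => f (z.1, w1 z.1.1.1.1)) => //.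
by split => //; exact: (FB_transfer mw1 fB).
Qed.

Let target_var_ge0 : 0 <= target_var.
Proof.
rewrite /target_var variance_integral; apply: integral_ge0 => x _.
by rewrite lee_fin sqr_ge0.
Qed.

Variables (w : X -> Waux) (mw : measurable_fun setT w).

Let total f : FB S f ->
  'V_P[score S f P w] = target_var + \int[m]_x cond_var S f P w x.
Proof. by move=> fB; exact: total_variance. Qed.

Let int_ge0 f : 0 <= \int[m]_x cond_var S f P w x.
Proof. by apply: integral_ge0 => x _; exact: cond_var_ge0. Qed.

Let finite_int h : finite_vars w h -> \int[m]_x h x < +oo.
Proof.
move=> [f [fB]]; rewrite total// => Vf <-.
by apply: le_lt_trans Vf; rewrite leeDr.
Qed.

(** Pasting along the set where the first conditional variance is the smaller one realizes the
    minimum. Its integral is at most that of [h1], so the pasted score has finite variance. *)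
Let finite_min h1 h2 : finite_vars w h1 -> finite_vars w h2 ->
  finite_vars w (fun x => mine (h1 x) (h2 x)).
Proof.
move=> [f1 [fB1 V1] <-] [f2 [fB2 V2] <-].
have mc1 := measurable_cond_var lP fB1 mw.
have mc2 := measurable_cond_var lP fB2 mw.
pose B := [set x | cond_var S f1 P w x < cond_var S f2 P w x].
have mB : measurable B by rewrite -[B]setTI; exact: measurable_lte.
pose f3 : ambient -> R := fun z => if z.1.1.1.1 \in B then f1 z else f2 z.
have fB3 : FB S f3 by exact: FB_paste.
have E3 : cond_var S f3 P w =
    (fun x => mine (cond_var S f1 P w x) (cond_var S f2 P w x)).
  apply/funext => x; rewrite /mine.
  have s3 : (fun y => score S f3 P w (x, y)) = if x \in B
      then (fun y => score S f1 P w (x, y)) else (fun y => score S f2 P w (x, y)).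
    by apply/funext => y; rewrite /score /plug /f3 /=; case: (x \in B).
  have xBE : (x \in B) = (cond_var S f1 P w x < cond_var S f2 P w x).
    by apply/idP/idP; rewrite inE.
  by rewrite -xBE {1}/cond_var s3; case: (x \in B).
rewrite -E3; exists f3 => //; split => //.
apply: le_lt_trans V1; rewrite !total// leeD2l// E3.
apply: ge0_le_integral => //.
- by move=> x _; rewrite le_min !cond_var_ge0.
- exact: measurable_mine.
- by move=> x _; rewrite ge_min lexx.
Qed.

Let int_Vmin : finite_vars w !=set0 -> \int[m]_x Vmin S P w x =
  ereal_inf [set \int[m]_x h x | h in finite_vars w].
Proof.
apply: integral_ess_inf_family.
- by move=> _ [f [fB _] <-]; exact: measurable_cond_var.
- by move=> _ x [f _ <-]; exact: cond_var_ge0.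
- exact: finite_int.
- exact: finite_min.
Qed.

Lemma Vlow_lower_bound f : FB S f -> Vlow S P w <= 'V_P[score S f P w].
Proof.
move=> fB; have [Vf|] := ltP 'V_P[score S f P w] +oo; last first.
  by rewrite leye_eq => /eqP ->; rewrite leey.
rewrite total//; apply: leeD2l.
have Hf : finite_vars w (cond_var S f P w) by exists f.
rewrite int_Vmin; last by exists (cond_var S f P w).
by apply: ereal_inf_lbound; exists (cond_var S f P w).
Qed.

Lemma Vlow_inf :
  ereal_inf [set 'V_P[score S f P w] | f in FB S] = Vlow S P w.
Proof.
apply/eqP; rewrite eq_le; apply/andP; split; last first.
  by apply: le_ereal_inf_tmp => _ [f fB <-]; exact: Vlow_lower_bound.
(* Without a score of finite variance the floor is infinite, the essential infimum of an empty
   family being [+oo]. *)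
have [H0|/set0P Hn0] := eqVneq (finite_vars w) set0.
  rewrite /Vlow [X in _ + X](_ : _ = +oo); last exact: integral_ess_inf_empty.
  rewrite addey ?leey// gt_eqF//.
  by apply: lt_le_trans target_var_ge0; exact: ltNyr.
rewrite /Vlow int_Vmin//; set c := ereal_inf [set \int[m]_x h x | h in _].
have [h0 Hh0] := Hn0.
have cfin : c \is a fin_num.
  rewrite ge0_fin_numE; last first.
    apply: le_ereal_inf_tmp => _ [_ [f _ <-] <-]; exact: int_ge0.
  by apply: le_lt_trans (finite_int Hh0); apply: ereal_inf_lbound; exists h0.
apply/lee_addgt0Pr => e e0.
have [_ [_ [f [fB Vf] <-] <-] hc] := lb_ereal_inf_adherent e0 cfin.
apply: (@le_trans _ _ 'V_P[score S f P w]).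
  by apply: ereal_inf_lbound; exists f.
by rewrite total// -addeA; apply: leeD2l; exact: ltW.
Qed.

End floor.

End variance_floor.

(** * Substitution of conditional laws *)

Section lower_integral.
Import HBNNSimple.

(** No measurability is assumed: the integral is then a lower integral. *)
Lemma integral_conull d (T : measurableType d) (R : realType)
    (m : measure T R) (G : set T) (f : T -> \bar R) :
  measurable G -> m (~` G) = 0 -> \int[m]_x f x = \int[m]_(x in G) f x.
Proof.
move=> mG G0; rewrite [RHS]integral_mkcond.
suff sup_eq (g : T -> \bar R) : (forall x, 0 <= g x) ->
    [set sintegral m h | h in [set h : {nnsfun T >-> R} |
      forall x, (h x)%:E <= g x]] =
    [set sintegral m h | h in [set h : {nnsfun T >-> R} |
      forall x, (h x)%:E <= (g \_ G) x]].
  rewrite /integral !patch_setT !funepos_restrict !funeneg_restrict.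
  by congr (ereal_sup _ - ereal_sup _); apply: sup_eq.
move=> g0; apply/seteqP; split=> _ [h hg <-]; last first.
  exists h => // x; apply: le_trans (hg x) _; rewrite patchE.
  by case: ifP.
(* A simple function below [g], cut off outside [G], is below the restriction of [g] and keeps its
   integral. *)
exists (proj_nnsfun h mG).
  move=> x /=; rewrite patchE mindicE; case: ifP => _.
    by rewrite mulr1; exact: hg.
  by rewrite mulr0.
rewrite -!integralT_nnsfun; apply: ge0_ae_eq_integral => //.
- exact/measurable_EFinP.
- exact/measurable_EFinP.
- by move=> x _; rewrite lee_fin.
- by move=> x _; rewrite lee_fin.
exists (~` G); split => //; first exact: measurableC.
move=> x /=; apply: contra_not => Gx _.
by rewrite mindicE mem_set// mulr1.
Qed.

End lower_integral.

Section separation.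
Context {R : realType} {d : measure_display} {T : polishType R d}.

(** The sets that do not separate [x] from [y] form a sigma-algebra. If it contained all generators,
    it would contain the open ball around [x] of radius [dist M x y], which holds [x] and not
    [y]. *)
Lemma countable_separation : exists B : nat -> set T,
  (forall n, measurable (B n)) /\
  forall x y, (forall n, B n x <-> B n y) -> x = y.
Proof.
have [G [mGE _ mG]] := @countable_pi_system R d T.
exists G; split => // x y xy.
suff sep (A : set T) : measurable A -> A x <-> A y.
  have [M] := @dense_metric_exists R d T.
  apply: (@dist_eq0 _ _ _ M); apply/eqP; rewrite eq_sym; apply/negPn/negP => nxy.
  have xy0 : (0 < dist M x y)%R.
    have := dist_triangle M x y x; rewrite distxx (distC M y x) => H.
    by rewrite lt_neqAle nxy; lra.
  have := (sep _ (@measurable_dist _ _ _ M x (dist M x y))).1; rewrite /= distxx.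
  by move=> /(_ xy0); rewrite ltxx.
rewrite mGE; move: A.
apply: (@smallest_sub _ _ _ [set A | A x <-> A y]) => [|_ [n _ <-]]; last exact: xy.
split=> [//|A /= Axy|F /= Fxy].
- by split=> -[_ nA]; split => // /Axy.
- by split=> -[n _ /Fxy Fn]; exists n.
Qed.

Lemma measurable_eq_fun d' (Z : measurableType d') (g h : Z -> T) :
  measurable_fun setT g -> measurable_fun setT h ->
  measurable [set z | g z = h z].
Proof.
move=> mg mh; have [B [mB sepB]] := countable_separation.
have mgB n : measurable (g @^-1` B n) by rewrite -[X in measurable X]setTI; exact: mg.
have mhB n : measurable (h @^-1` B n) by rewrite -[X in measurable X]setTI; exact: mh.
rewrite (_ : [set z | _] = \bigcap_n
    ((g @^-1` B n `&` h @^-1` B n) `|` (~` (g @^-1` B n) `&` ~` (h @^-1` B n)))).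
  apply: bigcapT_measurable => n; apply: measurableU; apply: measurableI => //;
    exact: measurableC.
apply/seteqP; split => z /=.
  by move=> gh n _ /=; rewrite -gh; have [|] := pselect (B n (g z)); [left|right].
move=> h1; apply: sepB => n; by case: (h1 n I) => /= -[gB hB]; split.
Qed.

End separation.

Section law_invariance.
Context {R : realType} {dW : measure_display} {W : measurableType dW}.
Local Notation law := (pprobability W R).
Implicit Types q r : law.

(** The sigma-algebra on laws is generated by evaluations at measurable sets, which cannot tell
    apart two terms equal under [measure_eq]. *)
Lemma law_invariant (V : set law) q r : measurable V ->
  measure_eq (q : probability W R) (r : probability W R) -> V q -> V r.
Proof.
move=> mV qr; suff : V q <-> V r by case.
move: V mV; apply: (@smallest_sub _ _ _ [set V : set law | V q <-> V r]).
  split=> [//|A /= Aqr|F /= Fqr].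
  - by split=> -[_ nA]; split => // /Aqr.
  - by split=> -[n _ /Fqr Fn]; exists n.
by move=> _ [e _ [B mB <-]]; rewrite /= /mset /= (qr B mB).
Qed.

Lemma law_invariant_fun d (T : polishType R d) (g : law -> T) q r :
  measurable_fun setT g ->
  measure_eq (q : probability W R) (r : probability W R) -> g q = g r.
Proof.
move=> mg qr; have [B [mB sepB]] := @countable_separation R d T.
apply: sepB => n.
have mgB : measurable (g @^-1` B n) by rewrite -[X in measurable X]setTI; exact: mg.
split; first exact: (law_invariant mgB qr).
by apply: (law_invariant mgB) => A mA; rewrite qr.
Qed.

Lemma law_pair_invariant d (X : measurableType d) (B : set (X * (law * law))) x q r q' r' :
  measurable B ->
  measure_eq (q : probability W R) (q' : probability W R) ->
  measure_eq (r : probability W R) (r' : probability W R) ->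
  B (x, (q, r)) -> B (x, (q', r')).
Proof.
move=> mB qq rr Bqr.
have mq : measurable [set q0 : law | B (x, (q0, r))].
  rewrite -[X in measurable X]setTI.
  have mp : measurable_fun setT (fun q0 : law => (x, (q0, r))).
    by apply: measurable_fun_pair => //; exact: measurable_fun_pair.
  exact: mp.
have mr : measurable [set r0 : law | B (x, (q', r0))].
  rewrite -[X in measurable X]setTI.
  have mp : measurable_fun setT (fun r0 : law => (x, (q', r0))).
    by apply: measurable_fun_pair => //; exact: measurable_fun_pair.
  exact: mp.
exact: (law_invariant mr rr (law_invariant mq qq Bqr)).
Qed.

End law_invariance.

Lemma measurable_extension d d' (Z : measurableType d) (T : measurableType d')
    (G : set Z) (g : Z -> T) : measurable G -> measurable_fun G g ->
  measurable_fun setT (fun z => if z \in G then g z else point).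
Proof.
move=> mG mg; have GE : (mem G) @^-1` [set true] = G.
  by apply/seteqP; split => z /=; [exact: set_mem|exact: mem_set].
apply: measurable_fun_if => //.
  by apply: (measurable_fun_bool true); rewrite setTI GE.
by rewrite setTI GE.
Qed.

Section kernel_substitution.
Context {R : realType} {d : nat} {dX dW dU dK dA : measure_display}
  {dN : 'I_d -> measure_display}
  {X : polishType R dX} {W : polishType R dW} {U : polishType R dU}
  {N0 : forall j : 'I_d, polishType R (dN j)}
  {K0 : polishType R dK} {Waux : polishType R dA}.

Local Notation XW := (X * W)%type.
Local Notation N := (nprod (fun j => N0 j)).
Local Notation ambient := (X * W * N * K0 * Waux)%type.
Local Notation law := (pprobability W R).

Variables (S : framework X W U N0 K0) (L : local_rules X W N0 K0).
Hypotheses (mG : measurable (adm_graph L)) (closed : reweighting_closure S)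
  (subst : kernel_substitution S L) (local : locality S L)
  (lm : local_measurability S L).
Variables (P : probability XW R) (lP : laws S P).

Let m := marginal P.
Let G : set (X * law) := adm_graph L.
(** [E], [K] and [C] are total Borel extensions of local rules whose measurability is assumed on the
    graph. *)
Let E (p : X * law) : N := if p \in G then eta_loc L p.1 p.2 else point.
Let K (p : X * law) : K0 := if p \in G then kappa_loc L p.1 p.2 else point.
Let C (p : X * law) : R := if p \in G then cost L p.1 p.2 else point.

Let EE x (q : probability W R) : adm L x q -> E (x, q) = eta_loc L x q.
Proof. by move=> Gq; rewrite /E mem_set. Qed.

Let KE x (q : probability W R) : adm L x q -> K (x, q) = kappa_loc L x q.
Proof. by move=> Gq; rewrite /K mem_set. Qed.

Let CE x (q : probability W R) : adm L x q -> C (x, q) = cost L x q.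
Proof. by move=> Gq; rewrite /C mem_set. Qed.

Let mE : measurable_fun setT E.
Proof. by apply: measurable_extension => //; have [] := lm. Qed.

Let mK : measurable_fun setT K.
Proof. by apply: measurable_extension => //; have [] := lm. Qed.

Let mC : measurable_fun setT C.
Proof. by apply: measurable_extension => //; have [] := lm. Qed.

Let mQ : measurable_fun setT (Q S P : X -> law).
Proof. exact: (Q_cond lP).1. Qed.

Let measurable_graph (q : X -> law) : measurable_fun setT q ->
  measurable_fun setT (fun x => (x, q x)).
Proof. by move=> mq; exact: measurable_fun_pair. Qed.

Let mEl l : measurable_fun setT (fun p => E p l).
Proof.
refine (measurableT_comp (@measurable_nprod_coord _ _ (fun j => N0 j) l) mE).
Qed.

(** Argued by coordinates, since [law_invariant_fun] asks for a Polish target and [nprod] carries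
    only a sigma-algebra. *)
Let E_invariant x (q r : probability W R) : measure_eq q r -> E (x, q) = E (x, r).
Proof.
move=> qr; apply: functional_extensionality_dep => l.
apply: (@law_invariant_fun _ _ W _ _ (fun q : law => E (x, q) l)) => //.
exact: measurableT_comp (@mEl l) (pair1_measurable x).
Qed.

Let K_invariant x (q r : probability W R) : measure_eq q r -> K (x, q) = K (x, r).
Proof.
move=> qr; apply: (@law_invariant_fun _ _ W _ _ (fun q : law => K (x, q))) => //.
exact: measurableT_comp mK (pair1_measurable x).
Qed.

Let regular : set X := [set x | adm L x (Q S P x)].

Let measurable_regular : measurable regular.
Proof.
rewrite -[regular]setTI; exact: (measurable_graph mQ measurableT mG).
Qed.

Let regular_conull : m (~` regular) = 0.
Proof.
have [_ + _ _] := subst; move=> /(_ P lP) reg.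
by apply/negligibleP => //; exact: measurableC.
Qed.

Section substituted.
Variables (A : set X) (mA : measurable A) (q : X -> law)
  (mq : measurable_fun setT q) (b : R).
Hypothesis Aq : forall x, A x ->
  [/\ regular x, adm L x (q x) & (C (x, q x) <= b)%R].

Definition substituted (x : X) : probability W R :=
  if x \in A then q x else Q S P x.

Let measurable_substituted : measurable_fun setT (substituted : X -> law).
Proof.
apply: measurable_fun_ifT => //; apply: (measurable_fun_bool true).
rewrite setTI [X in measurable X](_ : _ = A)//.
by apply/seteqP; split => x; [exact: set_mem|exact: mem_set].
Qed.

Let adm_substituted x : regular x -> adm L x (substituted x).
Proof.
move=> rx; rewrite /substituted; case: ifPn => // /set_mem Ax.
by have [] := Aq Ax.
Qed.

Let regular_ae : \forall x \ae m, regular x.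
Proof. by exists (~` regular); split => //; exact: measurableC. Qed.

Let cost_substituted : \int[m]_x (cost L x (substituted x))%:E < +oo.
Proof.
have [cost1 _ + _] := subst; move=> /(_ P lP).
(* [cost] is Borel only on the graph, so these are lower integrals; restricted to the conull set
   [regular], the integrands become measurable. *)
rewrite -/m !(integral_conull _ measurable_regular regular_conull) => cQ.
have mcost (k : X -> law) : measurable_fun setT k ->
    (forall x, regular x -> adm L x (k x)) ->
    measurable_fun regular (fun x => (cost L x (k x))%:E).
  move=> mk adk.
  apply: (eq_measurable_fun (fun x => (C (x, k x))%:E)).
    by move=> x /set_mem rx; rewrite CE//; exact: adk.
  apply/measurable_EFinP; apply: measurable_funTS.
  exact: measurableT_comp mC (measurable_graph mk).
have mcQ := mcost _ mQ (fun x rx => rx).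
have c0 x (r : probability W R) : adm L x r -> 0 <= (cost L x r)%:E.
  by move=> /cost1; rewrite lee_fin; apply: le_trans.
(* The maximum with 0 is there because [b] may be negative when [A] is empty. *)
apply: (@le_lt_trans _ _
    (\int[m]_(x in regular) ((cost L x (Q S P x))%:E + (Num.max b 0)%:E))).
  apply: ge0_le_integral => //.
  - by move=> x rx; apply: c0; exact: adm_substituted.
  - exact: mcost.
  - by apply: emeasurable_funD => //; exact: measurable_cst.
  - move=> x rx; rewrite /substituted; case: ifPn => [/set_mem Ax|_].
      have [_ aq Cb] := Aq Ax; rewrite -(CE aq).
      rewrite -[leLHS]add0e; apply: leeD; first exact: c0.
      by rewrite lee_fin le_max Cb.
    by rewrite leeDl// lee_fin le_max lexx orbT.
rewrite ge0_integralD//; last 2 first.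
- by move=> x rx; exact: c0.
- by move=> x _; rewrite lee_fin le_max lexx orbT.
rewrite integral_cst//; apply: lte_add_pinfty => //.
by rewrite -ge0_fin_numE ?mule_ge0 ?lee_fin ?le_max ?lexx ?orbT// fin_numM// fin_num_measure.
Qed.

(** [Q S P1] matches the new kernel only off a null set and up to [measure_eq]. Locality gives the
    nuisances at [Q S P1], and invariance moves them to [substituted]. *)
Lemma substituted_law : exists P1, [/\ laws S P1,
  measure_eq (marginal P1) m,
  \forall x \ae m, measure_eq (Q S P1 x) (substituted x)
  & \forall x \ae m, eta S P1 x = E (x, substituted x) /\
      kappa S P1 x = K (x, substituted x)].
Proof.
have [P1 J1] := joint_law_exists m measurable_substituted.
have um : universally_measurable R (substituted : X -> law).
  move=> mu B mB; exists (substituted @^-1` B).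
    by rewrite -[X in measurable X]setTI; exact: measurable_substituted.
  by rewrite setYK; exact: negligible_set0.
have lP1 : laws S P1.
  have [_ _ _ +] := subst; move=> /(_ P lP _ um); apply.
  - by apply: filterS regular_ae => x; exact: adm_substituted.
  - exact: cost_substituted.
  - exact: measurable_substituted.
  - exact: aeW.
  - exact: J1.
have marg1 := marginal_joint_law J1.
have dom B : measurable B -> marginal P1 B = 0 -> m B = 0.
  by move=> mB; rewrite -marg1.
have QE : \forall x \ae m, measure_eq (Q S P1 x) (substituted x).
  apply: (ae_dominated dom).
  exact: cond_law_unique (Q_cond lP1).1 measurable_substituted marg1 (Q_cond lP1).2 J1.
exists P1; split => //.
have [_ admQ _ _] := subst.
have := ae_dominated dom (admQ _ lP1); have := ae_dominated dom (local lP1).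
apply: filterS3 QE => x QE [-> -> _] adQ.
by rewrite -(EE adQ) -(KE adQ) (E_invariant x QE) (K_invariant x QE).
Qed.

End substituted.

Variables (f : ambient -> R) (fB : FB S f) (w : X -> Waux)
  (mw : measurable_fun setT w).

Let h (p : (X * (law * law)) * W) : R :=
  f (p.1.1, p.2, E (p.1.1, p.1.2.2), kappa S P p.1.1, w p.1.1).

Let absmean (z : X * (law * law)) : \bar R :=
  \int[z.2.1 : probability W R]_y `|(h (z, y))%:E|.

Let mean (z : X * (law * law)) : \bar R :=
  \int[z.2.1 : probability W R]_y (h (z, y))%:E.

Let pbar (x : X) : R := psi_bar S (x, eta S P x, kappa S P x).

(** The pairs of laws that refute the claim at [x], by divergence or by a wrong mean. The value [v]
    is the [j]-th coordinate of [E] at the second law, so only laws have to be selected. The eta are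
    compared by coordinates, in Polish spaces, where [measurable_eq_fun] applies. *)
Let bad (j : 'I_d) : set (X * (law * law)) :=
  [set z | [/\ G (z.1, z.2.1) /\ G (z.1, z.2.2),
    forall l, E (z.1, z.2.1) l = eta S P z.1 l,
    K (z.1, z.2.1) = kappa S P z.1,
    forall l, l != j -> E (z.1, z.2.2) l = eta S P z.1 l
    & ~ (absmean z < +oo /\ mean z = (pbar z.1)%:E)]].

Let mp1 : measurable_fun setT (fun z : X * (law * law) => (z.1, z.2.1)).
Proof.
apply: measurable_fun_pair; first exact: measurable_fst.
exact: measurableT_comp measurable_fst measurable_snd.
Qed.

Let mp2 : measurable_fun setT (fun z : X * (law * law) => (z.1, z.2.2)).
Proof.
apply: measurable_fun_pair; first exact: measurable_fst.
exact: measurableT_comp measurable_snd measurable_snd.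
Qed.

Let mh : measurable_fun setT h.
Proof.
have m1 : measurable_fun setT (fun p : (X * (law * law)) * W => p.1.1).
  exact: measurableT_comp measurable_fst measurable_fst.
apply: (measurableT_comp fB.1); apply: measurable_fun_pair; last first.
  exact: measurableT_comp mw m1.
apply: measurable_fun_pair; last exact: measurableT_comp (kappa_meas lP) m1.
apply: measurable_fun_pair.
  by apply: measurable_fun_pair; [exact: m1|exact: measurable_snd].
exact: measurableT_comp mE (measurableT_comp mp2 measurable_fst).
Qed.

Let mfirst : measurable_fun setT (fun z : X * (law * law) => z.2.1).
Proof. exact: measurableT_comp measurable_fst measurable_snd. Qed.

Let measurable_absmean : measurable_fun setT absmean.
Proof.
apply: (measurable_cond_integral (h := fun p => `|(h p)%:E|) mfirst) => //.
by apply: measurableT_comp => //; exact/measurable_EFinP.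
Qed.

Let measurable_mean : measurable_fun setT mean.
Proof.
have mhE : measurable_fun setT (EFin \o h) by exact/measurable_EFinP.
have := emeasurable_funB
  (measurable_cond_integral (h := (EFin \o h)^\+) mfirst
     (measurable_funepos mhE) (funepos_ge0 _))
  (measurable_cond_integral (h := (EFin \o h)^\-) mfirst
     (measurable_funeneg mhE) (funeneg_ge0 _)).
apply: eq_measurable_fun => z _.
rewrite /mean [RHS]integralE; congr (_ - _); apply: eq_integral => y _.
  by rewrite !funeposE.
by rewrite !funenegE.
Qed.

Let measurable_pbar : measurable_fun setT pbar.
Proof.
apply: (measurableT_comp (psi_bar_meas S)).
apply: measurable_fun_pair; last exact: kappa_meas.
by apply: measurable_fun_pair => //; exact: measurable_eta.
Qed.

Let measurable_bad j : measurable (bad j).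
Proof.
have mGp (p : X * (law * law) -> X * law) :
    measurable_fun setT p -> measurable (p @^-1` G).
  by move=> mp; rewrite -[X in measurable X]setTI; exact: mp.
have meta (p : X * (law * law) -> X * law) l : measurable_fun setT p ->
    measurable [set z | E (p z) l = eta S P z.1 l].
  move=> mp; apply: measurable_eq_fun.
    exact: measurableT_comp (@mEl l) mp.
  exact: measurableT_comp (eta_meas lP (j := l)) measurable_fst.
have mall (F : 'I_d -> set (X * (law * law))) (p : pred 'I_d) :
    (forall l, measurable (F l)) -> measurable [set z | forall l, p l -> F l z].
  move=> mF.
  rewrite [X in measurable X](_ : _ = \bigcap_l (if p l then F l else setT)).
    rewrite -[X in measurable X]setCK setC_bigcap; apply: measurableC.
    apply: countable_bigcupT_measurable => // l; apply: measurableC.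
    by case: ifP.
  apply/seteqP; split => z /= H l; first by move=> _; case: ifP => // /H.
  by move=> pl; have := H l I; rewrite pl.
rewrite (_ : bad j = ((fun z => (z.1, z.2.1)) @^-1` G `&`
    (fun z => (z.1, z.2.2)) @^-1` G) `&`
  ([set z | forall l : 'I_d, xpredT l -> E (z.1, z.2.1) l = eta S P z.1 l] `&`
   [set z | K (z.1, z.2.1) = kappa S P z.1]) `&`
  ([set z | forall l : 'I_d, l != j -> E (z.1, z.2.2) l = eta S P z.1 l] `&`
   ~` ([set z | absmean z < +oo] `&` [set z | mean z = (pbar z.1)%:E]))).
  apply: measurableI; first apply: measurableI.
  - by apply: measurableI; exact: mGp.
  - apply: measurableI; first by apply: mall => l; exact: meta.
    apply: measurable_eq_fun; first exact: measurableT_comp mK mp1.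
    exact: measurableT_comp (kappa_meas lP) measurable_fst.
  - apply: measurableI; first by apply: mall => l; exact: meta.
    apply: measurableC; apply: measurableI.
      by rewrite -[X in measurable X]setTI; exact: emeasurable_fun_infty_o.
    rewrite -[X in measurable X]setTI; apply: measurable_eqe => //.
    by apply/measurable_EFinP; exact: measurableT_comp measurable_pbar measurable_fst.
apply/seteqP; split => z /=.
  by move=> [[G1 G2] H1 H2 H3 H4]; split; [split; [|split=> // l _; exact: H1]|].
by move=> [[G12 [H1 H2]] [H3 H4]]; split => // l; exact: H1.
Qed.

(** If [bad j] held on a set of positive mass, a measurable selection [(q, r)]
    there would yield two laws of the model, with kernels [q] and [r] on that
    set, that violate the conditional moment identity. *)
Let bad_selection_absurd j (A : set X) (q r : X -> law) (b : R) :
  measurable A -> 0 < m A ->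
  measurable_fun setT q -> measurable_fun setT r ->
  (forall x, A x -> [/\ regular x, (C (x, q x) <= b)%R, (C (x, r x) <= b)%R
     & bad j (x, (q x, r x))]) -> False.
Proof.
move=> mA A0 mq mr Abad.
have Aq x : A x -> [/\ regular x, adm L x (q x) & (C (x, q x) <= b)%R].
  by move=> /Abad[rx cq _ [[Gq _]]].
have Ar x : A x -> [/\ regular x, adm L x (r x) & (C (x, r x) <= b)%R].
  by move=> /Abad[rx _ cr [[_ Gr]]].
have [P1 [lP1 marg1 QE1 loc1]] := substituted_law mA mq Aq.
have [P2 [lP2 marg2 _ loc2]] := substituted_law mA mr Ar.
have dom1 B : measurable B -> m B = 0 -> marginal P1 B = 0.
  by move=> mB B0; rewrite marg1.
have dom1' B : measurable B -> marginal P1 B = 0 -> m B = 0.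
  by move=> mB; rewrite marg1.
have offA x (k : X -> law) : ~ A x -> substituted A k x = Q S P x.
  by move=> nA; rewrite /substituted memNset.
have onA x (k : X -> law) : A x -> substituted A k x = k x.
  by move=> Ax; rewrite /substituted mem_set.
have [_ admQ _ _] := subst.
(* On [A] because [q x] has the nuisances of [P] at [x], off [A] because the kernel is unchanged. *)
have same1 : \forall x \ae m, eta S P1 x = eta S P x /\ kappa S P1 x = kappa S P x.
  apply: filterS3 loc1 (local lP) (admQ _ lP) => x [-> ->] [eP kP _] aP.
  have [Ax|nAx] := pselect (A x); last by rewrite offA// EE// KE.
  rewrite onA//; have [_ _ _ [_ Eq Kq _ _]] := Abad x Ax; split => //.
  by apply: functional_extensionality_dep => l; exact: Eq.
have nb : neighbor S P1 P2.
  exists j => l lj; apply: (ae_dominated dom1).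
  apply: filterS3 loc2 same1 (filterI (local lP) (admQ _ lP)) => x.
  move=> [-> _] [-> _] [[eP _ _] aP].
  have [Ax|nAx] := pselect (A x); last by rewrite offA// EE// eP.
  by rewrite onA//; have [_ _ _ [_ _ _ Er _]] := Abad x Ax; exact: Er.
(* The first law has kernel [q] and the kappa of [P], the second supplies [E] at [r]: on [A], the
   identity for this pair is what [bad j] denies. *)
have cm := ae_dominated dom1' (cond_mean_neighbor closed lP1 lP2 mw nb fB).
have pb := ae_dominated dom1' (psi_barE lP1).
have : \forall x \ae m, ~ A x.
  apply: filterS3 (filterI cm pb) (filterI loc2 same1) QE1 => x.
  move=> [[ci ce] pbx] [[e2 _] [e1 k1]] Qx Ax.
  have [_ _ _ [_ _ _ _ nbad]] := Abad x Ax; apply: nbad.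
  rewrite onA// in Qx; rewrite onA// in e2.
  have qQ : measure_eq (q x : probability W R) (Q S P1 x).
    by move=> B mB; rewrite Qx.
  have hE y : plug f (eta S P2) (kappa S P1) w (x, y) = h ((x, (q x, r x)), y).
    by rewrite /plug /h /= e2 k1.
  rewrite /absmean /mean /=; split.
    rewrite (integral_measure_eq _ qQ).
    move/integrableP : ci => [_]; congr (_ < _).
    by apply: eq_integral => y _; rewrite hE.
  rewrite (integral_measure_eq _ qQ) /pbar -e1 -k1 -pbx -ce.
  by apply: eq_integral => y _; rewrite hE.
move=> [B [mB B0 AB]].
have : m A <= m B by apply: le_measure; rewrite ?inE// => x Ax; exact: AB.
by rewrite B0 leNgt A0.
Qed.

Let bad_negligible j :
  m.-negligible [set x | exists q r : law, bad j (x, (q, r))].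
Proof.
have [M] := @dense_metric_exists R dW W.
pose dec (y : baire) : law * law := (law_of M (evens y), law_of M (odds y)).
have mdec1 : measurable_fun setT (fun y => law_of M (evens y) : law).
  exact: measurableT_comp (measurable_law_of M) (measurable_reindex double).
have mdec2 : measurable_fun setT (fun y => law_of M (odds y) : law).
  exact: measurableT_comp (measurable_law_of M) (measurable_reindex (succn \o double)).
have mdec : measurable_fun setT dec by exact: measurable_fun_pair.
pose B := (fun z : X * baire => (z.1, dec z.2)) @^-1` bad j.
have mB : measurable B.
  rewrite -[B]setTI.
  suff : measurable_fun setT (fun z : X * baire => (z.1, dec z.2)) by apply.
  apply: measurable_fun_pair; first exact: measurable_fst.
  exact: measurableT_comp mdec measurable_snd.
apply: contrapT => nneg.
have [|A [y [mA A0 my yB]]] := measurable_selection mB (m := m).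
  apply: contra_not nneg; apply: negligibleS => x [q [r qr]].
  have [y1 y1q] := law_of_surj M q; have [y2 y2r] := law_of_surj M r.
  exists (fun n => if odd n then y2 n./2 else y1 n./2); rewrite /B /= /dec.
  rewrite (_ : evens _ = y1); last first.
    by apply/funext => i; rewrite /evens odd_double doubleK.
  rewrite (_ : odds _ = y2); last first.
    by apply/funext => i; rewrite /odds /= odd_double uphalf_double.
  (* The codes restore [q] and [r] only up to [measure_eq]. *)
  apply: (law_pair_invariant _ _ _ qr) => // D mD; first by rewrite y1q.
  by rewrite y2r.
pose q x : law := law_of M (evens (y x)); pose r x : law := law_of M (odds (y x)).
have mq : measurable_fun setT q by exact: measurableT_comp mdec1 my.
have mr : measurable_fun setT r by exact: measurableT_comp mdec2 my.
(* Substitution asks for a bounded cost. Costs being finite, these sets exhaust [A] up to a null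
   set, so one of them has positive mass. *)
pose An n := A `&` regular `&`
  ([set x | (C (x, q x) <= n%:R)%R] `&` [set x | (C (x, r x) <= n%:R)%R]).
have mle (k : X -> law) (n : nat) : measurable_fun setT k ->
    measurable [set x | (C (x, k x) <= n%:R)%R].
  move=> mk; rewrite -[X in measurable X]setTI.
  have mCk : measurable_fun setT (fun x => (C (x, k x))%:E).
    by apply/measurable_EFinP; exact: measurableT_comp mC (measurable_graph mk).
  exact: (emeasurable_fun_infty_c measurableT mCk n%:R%:E).
have mAn n : measurable (An n).
  by apply: measurableI; [exact: measurableI|apply: measurableI; exact: mle].
have [n An0] : exists n, 0 < m (An n).
  apply: contrapT => /forallNP noA.
  suff : m.-negligible A by move/(measure_negligible mA) => mA0; rewrite mA0 ltxx in A0.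
  apply: (@negligibleS _ _ _ _ ((\bigcup_n An n) `|` ~` regular)).
    move=> x Ax; have [rx|] := pselect (regular x); last by right.
    have [k1 ck1] : exists k, (C (x, q x) <= k%:R)%R.
      exists (Num.bound `|C (x, q x)|).
      by rewrite (le_trans (ler_norm _))// ltW// archi_boundP.
    have [k2 ck2] : exists k, (C (x, r x) <= k%:R)%R.
      exists (Num.bound `|C (x, r x)|).
      by rewrite (le_trans (ler_norm _))// ltW// archi_boundP.
    left; exists (maxn k1 k2) => //; split; first by split.
    split => /=; [apply: le_trans ck1 _|apply: le_trans ck2 _].
      by rewrite ler_nat leq_maxl.
    by rewrite ler_nat leq_maxr.
  apply: negligibleU; last first.
    by apply/negligibleP => //; exact: measurableC.
  apply: negligible_bigcup => n; apply/negligibleP => //.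
  apply/eqP; rewrite eq_le measure_ge0 andbT leNgt; apply/negP; exact: noA.
apply: (@bad_selection_absurd j (An n) q r n%:R) => //.
by move=> x [[Ax rx] [cq cr]]; split => //; exact: yB.
Qed.

Theorem kernel_robustness : \forall x \ae m,
  forall (j : 'I_d) (Q' : probability W R) (v : N0 j), fiber S L P x Q' ->
    (exists r, [/\ adm L x r,
       forall l : 'I_d, l != j -> eta_loc L x r l = eta S P x l
     & eta_loc L x r j = v]) ->
    let fx y := f (x, y, dfwith (eta S P x) j v, kappa S P x, w x) in
    Q'.-integrable setT (EFin \o fx) /\
    'E_Q'[fx] = (psi_bar S (x, eta S P x, kappa S P x))%:E.
Proof.
have : \forall x \ae m, forall j, ~ exists q r : law, bad j (x, (q, r)).
  (* The index [j] is embedded into [nat] to take a countable union of null sets; the condition is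
     void from [d] on. *)
  have : \forall x \ae m, forall n, forall j : 'I_d, n = j :> nat ->
      ~ exists q r : law, bad j (x, (q, r)).
    apply: ae_foralln => n; have [nd|dn] := ltnP n d.
      have nb : \forall x \ae m, ~ exists q r : law, bad (Ordinal nd) (x, (q, r)).
        by apply: negligibleS (@bad_negligible (Ordinal nd)) => x /contrapT.
      apply: filterS nb => x /= nbx j nj.
      by rewrite (_ : j = Ordinal nd)//; apply: val_inj.
    by apply: aeW => x j nj; have := ltn_ord j; rewrite -nj ltnNge dn.
  by apply: filterS => x H j; exact: (H j).
apply: filterS => x nbad j Q' v [aQ eQ kQ] [r [ar er ev]] fx.
(* Placing [v] in position [j] turns eta of [P] at [x] into the whole nuisance of [r], the form in
   which [bad] is stated. *)
have dE : dfwith (eta S P x) j v = eta_loc L x r.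
  apply: functional_extensionality_dep => l.
  have [->|lj] := eqVneq l j; first by rewrite dfwithin ev.
  by rewrite dfwithout ?er// eq_sym.
have hE y : h ((x, (Q', r)), y) = fx y by rewrite /h /fx /= EE// dE.
have mfx : measurable_fun setT fx.
  apply: (eq_measurable_fun (fun y => h ((x, (Q', r)), y))) => //.
  exact: measurableT_comp mh (pair1_measurable _).
have [am me] : absmean (x, (Q', r)) < +oo /\ mean (x, (Q', r)) = (pbar x)%:E.
  apply: contrapT => nmean; apply: (nbad j); exists Q', r; split => //=.
  - by move=> l; rewrite EE// eQ.
  - by rewrite KE.
  - by move=> l lj; rewrite EE// er.
split.
  apply/integrableP; split; first exact/measurable_EFinP.
  move: am; rewrite /absmean /=; congr (_ < _).
  by apply: eq_integral => y _; rewrite hE.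
rewrite expectation.unlock -[RHS]me /mean /=.
by apply: eq_integral => y _; rewrite hE.
Qed.

End kernel_substitution.

Theorem theorem4p4 (R : realType) (d : nat) (d_gt0 : (0 < d)%N)
    (dX dW dU dK dA : measure_display) (dN : 'I_d -> measure_display)
    (X : polishType R dX) (W : polishType R dW) (U : polishType R dU)
    (N0 : forall j : 'I_d, polishType R (dN j))
    (K0 : polishType R dK) (Waux : polishType R dA)
    (S : framework X W U N0 K0)
    (P : probability (X * W)%type R) (lawsP : laws S P)
    (w : X -> Waux) (mw : measurable_fun setT w) :
  (reweighting_closure S ->
     (* V_low does not depend on the auxiliary map w0 used to define it *)
     forall w0 : X -> Waux, measurable_fun setT w0 ->
     (forall f, FB S f ->
       [/\ \forall x \ae marginal P,
             cond_mean S f P w x = (psi S (x, u S P x))%:E,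
           'V_P[score S f P w] =
             'V_(marginal P)[fun x => psi S (x, u S P x)]
             + \int[marginal P]_x cond_var S f P w x
         & Vlow S P w0 <= 'V_P[score S f P w]]) /\
     ereal_inf [set 'V_P[score S f P w] | f in FB S] = Vlow S P w0)
  /\
  (forall L : local_rules X W N0 K0,
     measurable (adm_graph L) ->
     reweighting_closure S -> kernel_substitution S L -> locality S L ->
     local_measurability S L ->
     forall f, FB S f ->
       \forall x \ae marginal P,
         forall (j : 'I_d) (Q' : probability W R) (v : N0 j),
           fiber S L P x Q' ->
           (exists r : probability W R,
             [/\ adm L x r,
                 forall l : 'I_d, l != j -> eta_loc L x r l = eta S P x l
               & eta_loc L x r j = v]) ->
           let fx y := f (x, y, dfwith (eta S P x) j v, kappa S P x, w x) in
           Q'.-integrable setT (EFin \o fx) /\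
           'E_Q'[fx] = (psi_bar S (x, eta S P x, kappa S P x))%:E).
Proof.
split=> [closed w0 mw0|L mG closed subst local lm f fB]; last first.
  exact: kernel_robustness.
have VE : Vlow S P w0 = Vlow S P w.
  by rewrite /Vlow (Vmin_transfer S P mw0 mw).
rewrite VE; split=> [f fB|]; last exact: Vlow_inf.
split; last exact: Vlow_lower_bound.
- by have := cond_meanE d_gt0 closed lawsP fB mw; apply: filterS => x [].
- exact: total_variance.
Qed.
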